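(* For every integer $k \geq 0$ there exists a compact oriented manifold with boundary whose boundary is homeomorphic to the complex projective space $\mathbb{CP}^{2k+1}$.
   Context: $\mathbb{CP}^{m}$ denotes complex projective space of complex dimension $m$ (real dimension $2m$). Manifolds with boundary are topological manifolds with boundary. *)

(* Defs.v *)
From HB Require Import structures.
From mathcomp Require Import all_boot all_order all_algebra.
From mathcomp Require Import complex.
From mathcomp Require Import all_classical all_reals all_analysis.

Set Implicit Arguments.
Unset Strict Implicit.
Unset Printing Implicit Defensive.

Import Order.TTheory GRing.Theory Num.Theory.
Import numFieldNormedType.Exports.

Local Open Scope classical_set_scope.
Local Open Scope ring_scope.
Local Open Scope quotient_scope.

Definition homeomorphic (X Y : topologicalType) : Prop :=
  exists (f : X -> Y) (g : Y -> X),
    [/\ continuous f, continuous g, cancel f g & cancel g f].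

(* For n = 0 there is no coordinate and both [half_space] and [euclidean] are
   the one-point space, while [wall] is empty. *)
Definition euclidean (R : realType) (n : nat) : set 'rV[R]_n := setT.

Definition half_space (R : realType) (n : nat) : set 'rV[R]_n :=
  [set v | forall i : 'I_n, val i = 0%N -> 0 <= v 0 i].

Definition wall (R : realType) (n : nat) : set 'rV[R]_n :=
  [set v | exists2 i : 'I_n, val i = 0%N & v 0 i = 0].

(* A homeomorphism from an open subset of M onto a relatively open subset of
   the model H.  The two maps are total functions; their values outside
   [chart_dom] and its image are irrelevant. *)
Record chart (R : realType) (n : nat) (H : set 'rV[R]_n) (M : topologicalType) :=
  Chart {
    chart_dom : set M;
    chart_map : M -> 'rV[R]_n;
    chart_inv : 'rV[R]_n -> M;
    chart_dom_open : open chart_dom;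
    chart_image_open :
      exists2 V : set 'rV[R]_n, open V & chart_map @` chart_dom = V `&` H;
    chart_map_continuous : {within chart_dom, continuous chart_map};
    chart_inv_continuous :
      {within chart_map @` chart_dom, continuous chart_inv};
    chart_mapK : forall x, chart_dom x -> chart_inv (chart_map x) = x
  }.

Arguments euclidean : clear implicits.
Arguments half_space : clear implicits.
Arguments wall : clear implicits.

Definition manifold_with_boundary (R : realType) (n : nat)
    (M : topologicalType) : Prop :=
  [/\ hausdorff_space M, @second_countable M &
      forall x : M, exists c : chart (half_space R n) M, chart_dom c x].

Definition boundary (R : realType) (n : nat) (M : topologicalType) : set M :=
  [set x | exists2 c : chart (half_space R n) M,
             chart_dom c x & wall R n (chart_map c x)].

Arguments manifold_with_boundary : clear implicits.
Arguments boundary : clear implicits.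

Definition homotopic (R : realType) (X Y : topologicalType)
    (A : set X) (B : set Y) (f g : X -> Y) : Prop :=
  exists h : R * X -> Y,
    [/\ {within `[0, 1]%classic `*` A, continuous h},
        forall p, (`[0, 1]%classic `*` A) p -> B (h p),
        forall x, A x -> h (0, x) = f x &
        forall x, A x -> h (1, x) = g x].

(* h has local degree +1 at a: for every small r > 0, the map
   v |-> h (a + r v) - h a from the unit sphere to R^n \ {0} has the homotopy
   class of the inclusion, i.e. the class of degree +1.  The norm of 'rV[R]_n
   is the sup norm, so the unit sphere is the boundary of a cube. *)
Definition orientation_preserving_at (R : realType) (n : nat)
    (h : 'rV[R]_n -> 'rV[R]_n) (a : 'rV[R]_n) : Prop :=
  \forall r \near (0 : R)^'+,
    homotopic R [set v : 'rV[R]_n | `|v| = 1] [set v : 'rV[R]_n | v != 0]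
      (fun v => h (a + r *: v) - h a) id.

(* An orientation of a manifold with boundary is an orientation of its
   interior, given by an atlas of charts into R^n. *)
Definition oriented_atlas (R : realType) (n : nat) (M : topologicalType)
    (A : set (chart (euclidean R n) M)) : Prop :=
  (forall x : M, ~ boundary R n M x -> exists2 c, A c & chart_dom c x) /\
  (forall c d, A c -> A d -> forall x, chart_dom c x -> chart_dom d x ->
     orientation_preserving_at (chart_map d \o chart_inv c) (chart_map c x)).

Section ProjectiveSpace.
Context (R : realType) (m : nat).

(* [R[i]^o] is R[i] with its topology as a normed space over itself. *)
Definition punctured : set 'rV[R[i]^o]_m.+1 := [set v | v != 0].

Definition proportional (v w : punctured) : bool :=
  `[< exists2 c : R[i]^o, c != 0 & val w = c *: val v >].

Lemma proportional_refl : reflexive proportional.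
Proof. by move=> v; apply/asboolP; exists 1; rewrite ?oner_eq0 ?scale1r. Qed.

Lemma proportional_imp v w : proportional v w -> proportional w v.
Proof.
move=> /asboolP[c c0 vw]; apply/asboolP; exists c^-1; first by rewrite invr_eq0.
by rewrite vw scalerA mulVf ?scale1r.
Qed.

Lemma proportional_sym : symmetric proportional.
Proof. by move=> v w; apply/idP/idP; apply: proportional_imp. Qed.

Lemma proportional_trans : transitive proportional.
Proof.
move=> w v u /asboolP[c c0 vw] /asboolP[d d0 wu]; apply/asboolP.
by exists (d * c); rewrite ?mulf_neq0// wu vw scalerA.
Qed.

Definition proportional_rel :=
  EquivRel proportional proportional_refl proportional_sym proportional_trans.

(* CP^m = (C^(m+1) \ {0}) / C^* *)
Definition complex_projective : topologicalType :=
  quotient_topology {eq_quot proportional_rel}.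

End ProjectiveSpace.

(* Main.v *)
From HB Require Import structures.
Require Import Defs.
From mathcomp Require Import finmap all_boot all_order all_algebra all_fingroup.
From mathcomp Require Import complex.
From mathcomp Require Import all_classical all_reals all_analysis.
From mathcomp Require Import ring lra.
Import Order.TTheory GRing.Theory Num.Theory.
Import numFieldNormedType.Exports.

Set Implicit Arguments.
Unset Strict Implicit.
Unset Printing Implicit Defensive.
Local Open Scope classical_set_scope.
Local Open Scope ring_scope.
Local Open Scope quotient_scope.

(* CP^m for odd m carries the fixed-point free antiholomorphic involution
   tau [z] = [conj z J], where J is a real antisymmetric matrix with J^2 = -1.
   It reverses the orientation, so W = (CP^m x [-1, 1]) / ((x, t) ~ (tau x, - t))
   is an oriented compact manifold, and (x, 1) identifies CP^m with its boundary.
   That interior points do not lie on the boundary rests on the no-retraction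
   theorem for the cube, obtained from Kuhn's combinatorial lemma: the sum over
   all simplices of a triangulated grid of the mod 2 cup product of the
   coboundaries of the n labels does not change when a label is replaced by
   another one with the same values on the faces.  Transition maps are projective
   transformations, possibly composed with (conj, -1); near a point they are
   homotopic to C-linear isomorphisms, which are homotopic to the identity, and
   (conj, -1) is the multiplication by -1 on R^(m+1), an even-dimensional space,
   times the identity. *)

(** * Kuhn's lemma *)

(** Identify C^(m+1) with a quaternionic vector space: [tau] is then multiplication by the unit j. A
    fixed line tau z = c z would give - z = |c|^2 z, which is impossible. In affine coordinates
    conjugation contributes the sign (-1)^m and t -> - t one more sign, so the gluing respects
    orientations exactly for odd m, the same parity that allows J.

    Two definitions shape the proof. [boundary] quantifies over all topological charts, so excluding
    a point from it takes an invariance theorem and not only good charts. Degree +1 is expressed by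
    a homotopy into the nonzero vectors, so every transition map needs an explicit path that never
    meets 0.

    A class of W has two kinds of representatives, (x, t) and (tau x, - t), and a chart has to
    select one of them continuously. The function [sheet p] does so: it is positive near p and
    changes its sign under [tau]. *)

Section Parity.
Local Open Scope nat_scope.

Notation "\xor_ ( i < n ) F" := (\big[addb/false]_(i < n) F)
  (at level 41, F at level 41, i, n at level 50).
Notation "\xor_ i F" := (\big[addb/false]_i F)
  (at level 41, F at level 41, i at level 0).
Notation "\conj_ ( i < n ) F" := (\big[andb/true]_(i < n) F)
  (at level 36, F at level 36, i, n at level 50).

Lemma bump_ge h k : k < h -> bump h k = k.
Proof. by rewrite /bump; case: leqP => // _ _; rewrite add0n. Qed.

Lemma bump_le h k : h <= k -> bump h k = k.+1.
Proof. by rewrite /bump => ->. Qed.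

(** A cup product of coboundaries is a cocycle: [bump d] is the d-th face map of a simplex, and the
    sum runs over its faces. In the induction, the faces d <= r share the new last factor, and the
    two remaining ones share the first r factors. *)
Lemma cocycle_sum (T : Type) (f : nat -> T -> bool) (z : nat -> T) r :
  \xor_(d < r.+2) \conj_(k < r)
    (f k (z (bump d k)) (+) f k (z (bump d k.+1))) = false.
Proof.
elim: r => [|r IH]; first by rewrite !big_ord_recr !big_ord0.
rewrite big_ord_recr big_ord_recr /=.
set S0 := \big[addb/_]_(_ < r.+1) _.
rewrite !big_ord_recr /= (@bump_ge r.+1 r) // (@bump_le r.+1 r.+1) //.
rewrite (@bump_ge r.+2 r) // (@bump_ge r.+2 r.+1) //.
rewrite {}/S0.
under [\big[addb/_]_(_ < r.+1) _]eq_bigr => d _.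
  have dr := ltnSE (ltn_ord d).
  rewrite big_ord_recr /= (bump_le dr) (bump_le (leqW dr)); over.
rewrite /= -big_distrl /=.
move: IH; rewrite big_ord_recr /=.
set A := \big[_/_]_(_ < r.+1) _.
have tail d : d > r -> \conj_(i < r) (f i (z (bump d i)) (+) f i (z (bump d i.+1)))
    = \conj_(i < r) (f i (z i) (+) f i (z i.+1)).
  move=> rd; apply: eq_bigr => i _.
  by rewrite !bump_ge // (leq_trans _ rd) // ltnS // ltnW.
rewrite !tail //.
by case: A; case: (\conj_(_ < r) _); case: (f r (z r)); case: (f r (z r.+1)); case: (f r (z r.+2)).
Qed.

(* Leibniz rule for the cup product of the coboundaries of the [f k], [k <> j],
   with the 0-cochain [m] inserted at position [j]. *)
Lemma leibniz_sum (T : Type) (f : nat -> T -> bool) (m : T -> bool) N j r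
    (x : nat -> T) : N = j + r ->
  \xor_(d < N.+2)
    [&& m (x (bump d j)),
        \conj_(k < j) (f k (x (bump d k)) (+) f k (x (bump d k.+1))) &
        \conj_(k < r) (f (j + k).+1 (x (bump d (j + k)))
                         (+) f (j + k).+1 (x (bump d (j + k).+1)))]
  = [&& m (x j) (+) m (x j.+1),
        \conj_(k < j) (f k (x k) (+) f k (x k.+1)) &
        \conj_(k < r) (f (j + k).+1 (x (j + k).+1)
                         (+) f (j + k).+1 (x (j + k).+2))].
Proof.
move=> ->.
pose L (y : nat -> T) := \conj_(k < j) (f k (y k) (+) f k (y k.+1)).
pose P (y : nat -> T) := \conj_(k < r) (f (j + k).+1 (y (j + k)) (+) f (j + k).+1 (y (j + k).+1)).
have low d : d <= j -> [&& m (x (bump d j)), L (x \o bump d) & P (x \o bump d)]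
    = L (x \o bump d) && (m (x j.+1) && P (x \o succn)).
  move=> dj; rewrite bump_le // andbCA; congr [&& _, _ & _].
  apply: eq_bigr => k _; have djk : d <= j + k := leq_trans dj (leq_addr _ _).
  by rewrite /= (bump_le djk) (bump_le (leqW djk)).
have high d : [&& m (x (bump (j.+1 + d) j)), L (x \o bump (j.+1 + d)) &
      P (x \o bump (j.+1 + d))]
    = (m (x j) && L x) && \conj_(k < r)
        (f (j + k).+1 (x (j + bump d.+1 k)%N) (+) f (j + k).+1 (x (j + bump d.+1 k.+1)%N)).
  rewrite bump_ge ?ltnS ?leq_addr // -andbA; congr [&& _, _ & _].
    apply: eq_bigr => k _; have kj := ltn_ord k.
    by rewrite /= !bump_ge // ltnS (leq_trans _ (leq_addr _ _)) // ltnW.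
  by apply: eq_bigr => k _; rewrite /= addSnnS -(addnS j k) !bumpDl.
rewrite -(addnS j r) -addSn big_split_ord /=.
under eq_bigr => d _ do rewrite (low d (ltnSE (ltn_ord d))).
under [X in _ (+) X]eq_bigr => d _ do rewrite (high d).
rewrite -big_distrl -big_distrr /=.
(* By [cocycle_sum], the faces of the left factor with d <= j add up to its remaining last face
   [L x], and those of the right factor to its remaining first face [P (x \o succn)]. *)
have := cocycle_sum f x j; rewrite big_ord_recr /=.
rewrite [X in _ (+) X](_ : _ = L x); last first.
  by apply: eq_bigr => k _; rewrite !bump_ge // ltnS // ltnW.
have := cocycle_sum (fun k => f (j + k).+1) (fun k => x (j + k)%N) r.
rewrite big_ord_recl /=.
rewrite [X in X (+) _](_ : _ = P (x \o succn)); last first.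
  by apply: eq_bigr => k _; rewrite !bump_le // !addnS.
rewrite /L /P /=.
set a := \big[_/_]_(_ < r.+1) _; set b := \big[_/_]_(_ < j.+1) _.
set c := \big[_/_]_(_ < r) _; set d := \big[_/_]_(_ < j) _.
by case: a; case: b; case: c; case: d; case: (m _); case: (m _).
Qed.

(** Right multiplication by [t] exchanges even and odd permutations, so the two halves of the sum
    are equal. *)
Lemma xor_pair_cancel n (t : 'S_n) (g : 'S_n -> bool) :
  odd_perm t -> (forall s, g (s * t)%g = g s) -> \xor_s g s = false.
Proof.
move=> todd gt; rewrite (bigID (@odd_perm _)) /=.
rewrite (reindex_inj (mulIg t)) /=.
rewrite (eq_bigl (fun s : 'S_n => ~~ odd_perm s)); last first.
  by move=> s; rewrite odd_permM todd addbT.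
rewrite (eq_bigr g) => [|s _]; last exact: gt.
exact: addbb.
Qed.

Section Grid.
Variables (N p : nat).
Local Notation n := N.+1.
Local Notation point := ('I_n -> nat).
Local Notation cell := ({ffun 'I_n -> 'I_p} * 'S_n)%type.

(* The cell [(q, s)] is the simplex of the Freudenthal triangulation with
   vertices q, q + e_{s^-1 0}, q + e_{s^-1 0} + e_{s^-1 1}, ... *)
Definition vertex (c : cell) (k : nat) : point := fun i => c.1 i + (c.2 i < k).

Definition on_face (i : 'I_n) (b : nat) (y : nat -> point) :=
  forall k, k < n -> y k i = b.

Lemma vertex_le c k i : vertex c k i <= p.
Proof.
have := ltn_ord (c.1 i); rewrite /vertex; case: (_ < k); rewrite ?addn0 ?addn1 //.
exact: ltnW.
Qed.

(** The neighbour of a cell across facet 0: one step in the first direction of the path, which then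
    becomes the last direction. [ordS] wraps around, so this permutes the cells even at the end of
    the grid. *)
Definition shift_cell (c : cell) : cell :=
  ([ffun i => if c.2 i == ord0 then ordS (c.1 i) else c.1 i],
   (c.2 * perm (can_inj (@ord_predK n)))%g).

Lemma shift_cell_inj : injective shift_cell.
Proof.
move=> [q s] [q' s'] [+ /mulIg ss]; rewrite -{}ss => /ffunP eq.
congr pair; apply/ffunP => i.
by have := eq i; rewrite !ffunE /=; case: ifP => // _; exact: ordS_inj.
Qed.

(** Interior facets occur twice: an inner facet is shared with the cell in which two consecutive
    directions are swapped, and facet 0 of a cell is the last facet of its [shift_cell]. *)
Lemma facets_sum (w : (nat -> point) -> bool) :
  (forall y y', (forall k, k < n -> y k = y' k) -> w y = w y') ->
  (forall i y, (forall k j, y k j <= p) -> on_face i 0 y \/ on_face i p y -> w y = false) ->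
  \xor_c \xor_(d < n.+1) w (vertex c \o bump d) = false.
Proof.
move=> wE w0; rewrite exchange_big big_ord_recl big_ord_recr /=.
rewrite [X in _ (+) (X (+) _)]big1 /= => [|d _]; last first.
  rewrite -(pair_bigA _ (fun q s => w (vertex (q, s) \o bump (bump 0 d)))) /=.
  apply: big1 => q _.
  have d1n : d.+1 < n by rewrite ltnS.
  apply: (@xor_pair_cancel _ (tperm (widen_ord (leqnSn _) d) (Ordinal d1n))).
    by rewrite odd_tperm -(inj_eq val_inj) /= neq_ltn ltnSn.
  move=> s; apply: wE => k kn; apply/funext => i.
  rewrite /vertex /= permM; congr (_ + nat_of_bool _).
  have kd : bump (bump 0 d) k != d.+1 by rewrite eq_sym; exact: (neq_bump d.+1 k).
  case: tpermP => [->|->|//] /=.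
    by rewrite ltn_neqAle eq_sym kd.
  by rewrite [RHS]ltn_neqAle eq_sym kd.
rewrite [X in _ (+) X](_ : _ = \big[addb/false]_c w (vertex c \o bump 0)) ?addbb //.
rewrite (reindex_inj shift_cell_inj) /=; apply: eq_bigr => -[q s] _ /=.
pose i0 := (s^-1)%g ord0; have si0 : s i0 = ord0 by rewrite permKV.
(* If the shift wraps around, the two facets lie on the opposite faces p and 0 of the grid, and [w]
   vanishes on both. *)
have [wrap|nowrap] := eqVneq (q i0).+1 p.
  have -> : w (vertex (q, s) \o bump 0) = false.
    apply: (@w0 i0) => [k|]; first exact: vertex_le.
    by right=> k kn; rewrite /vertex /= si0 /= addn1 wrap.
  apply: (@w0 i0) => [k|]; first exact: vertex_le.
  left=> k kn; rewrite /vertex /= ffunE permM si0 permE eqxx /= wrap modnn.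
  by rewrite (@bump_ge (bump 0 N) k) // modn_small // ltnNge -ltnS kn.
apply: wE => k kn; apply/funext => i.
rewrite /vertex /= ffunE permM permE (@bump_ge (bump 0 N) k) // (@bump_le 0 k) //.
case: eqP => [s0|/eqP s0] /=; last first.
  congr (_ + nat_of_bool _).
  have spos : 0 < s i by rewrite lt0n; apply: contra s0 => /eqP s0; apply/eqP/val_inj.
  rewrite -{1}(prednK spos) addSn /= modnDr modn_small.
    by rewrite -ltnS prednK.
  by rewrite (leq_ltn_trans (leq_pred _)).
have ii0 : i = i0 by rewrite /i0 -s0 permK.
have Nk : (N < k) = false by rewrite ltnNge -ltnS kn.
rewrite s0 /= (modn_small (ltnSn N)) Nk addn0 addn1 modn_small ii0 //.
by rewrite ltn_neqAle nowrap ltn_ord.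
Qed.

Definition label := nat -> point -> bool.

Definition admissible (f : label) := forall (i : 'I_n) (x : point),
  (forall j, x j <= p) -> (x i = 0 -> f i x = false) /\ (x i = p -> f i x = true).

Definition flips (f : label) (c : cell) : bool :=
  \conj_(k < n) (f k (vertex c k) (+) f k (vertex c k.+1)).

Lemma conj_split (g : nat -> bool) M j r : M = j + r ->
  \conj_(k < M.+1) g k =
  [&& g j, \conj_(k < j) g k & \conj_(k < r) g (j + k).+1].
Proof.
move=> ->; rewrite -addnS big_split_ord big_ord_recl /= addn0 andbCA.
by congr [&& _, _ & _]; apply: eq_bigr => k _; rewrite addnS.
Qed.

(* The difference of the two sums is the sum of the cup products with the label [j]
   replaced by [m = f j + f' j]: a coboundary, of a cochain vanishing on the faces. *)
Lemma flips_sum_replace (f f' : label) (j : 'I_n) :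
  admissible f -> admissible f' -> (forall k : nat, k != j -> f k = f' k) ->
  \xor_c flips f c (+) \xor_c flips f' c = false.
Proof.
move=> fP f'P ff'; rewrite -big_split /=.
pose r := N - j; have Njr : N = j + r by rewrite subnKC // -ltnS.
pose m x := f j x (+) f' j x.
pose w (y : nat -> point) := [&& m (y j),
   \conj_(k < j) (f k (y k) (+) f k (y k.+1)) &
   \conj_(k < r) (f (j + k).+1 (y (j + k)) (+) f (j + k).+1 (y (j + k).+1))].
have fE c : flips f c (+) flips f' c = \xor_(d < n.+1) w (vertex c \o bump d).
  rewrite (leibniz_sum _ _ _ Njr).
  rewrite /flips (conj_split (fun k => f k (vertex c k) (+) f k (vertex c k.+1)) Njr).
  rewrite (conj_split (fun k => f' k (vertex c k) (+) f' k (vertex c k.+1)) Njr).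
  have -> : \conj_(k < j) (f' k (vertex c k) (+) f' k (vertex c k.+1)) =
      \conj_(k < j) (f k (vertex c k) (+) f k (vertex c k.+1)).
    by apply: eq_bigr => k _; rewrite ff' // neq_ltn ltn_ord.
  have -> : \conj_(k < r) (f' (j + k).+1 (vertex c (j + k).+1)
        (+) f' (j + k).+1 (vertex c (j + k).+2)) =
      \conj_(k < r) (f (j + k).+1 (vertex c (j + k).+1)
        (+) f (j + k).+1 (vertex c (j + k).+2)).
    by apply: eq_bigr => k _; rewrite ff' // neq_ltn ltnS leq_addr orbT.
  rewrite -andb_addl /m; congr (_ && _).
  by case: (f j _); case: (f j _); case: (f' j _); case: (f' j _).
under eq_bigr => c _ do rewrite fE.
apply: facets_sum.
  move=> y y' yy'; rewrite /w yy' //; congr [&& _, _ & _]; apply: eq_bigr => k _.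
    by rewrite !yy' // (leq_trans _ (ltn_ord j)) // ltnS // ltnW.
  have jkn : (j + k).+1 < n by have := ltn_ord k; rewrite -(ltn_add2l j) -Njr ltnS.
  by rewrite !yy' // ltnW.
move=> i y yp onf.
have fi b b' : b < n -> b' < n -> f i (y b) = f i (y b').
  by move=> bn b'n; have [F0 Fp] := fP i _ (yp b); have [F0' Fp'] := fP i _ (yp b');
    case: onf => onf; [rewrite F0 ?F0' ?onf|rewrite Fp ?Fp' ?onf].
(* On a face in direction i one factor of [w] vanishes: for i <> j the coboundary of label i, which
   is constant on the face, and for i = j the cochain [m], since both labels have the prescribed
   value there. *)
have [ij|ij|/val_inj ij] := ltngtP i j.
- rewrite /w (bigD1 (Ordinal ij)) //= (fi i i.+1) ?addbb ?andbF //.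
  by rewrite (leq_trans _ (ltn_ord j)).
- have kr : i - j.+1 < r by rewrite /r -(subSS j N) ltn_sub2r // (leq_ltn_trans ij).
  rewrite /w [X in _ && (_ && X)](bigD1 (Ordinal kr)) //=.
  have jk : (j + (i - j.+1)).+1 = i by rewrite -addSn subnKC.
  have jn : j + (i - j.+1) < n by rewrite jk ltnW.
  by rewrite jk (fi _ i) ?addbb ?andbF.
rewrite /w /m -ij.
have -> : f i (y i) = f' i (y i); last by rewrite addbb.
by have [F0 Fp] := fP i _ (yp i); have [F0' Fp'] := f'P i _ (yp i);
  case: onf => onf; [rewrite F0 ?F0' ?onf|rewrite Fp ?Fp' ?onf].
Qed.

Definition coordinate_label : label := fun k x =>
  if insub k is Some i then 0 < x i else true.

Hypothesis p_gt0 : 0 < p.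

Lemma coordinate_label_admissible : admissible coordinate_label.
Proof.
by move=> i x _; rewrite /coordinate_label valK; split=> ->.
Qed.

(** Label k changes between the vertices k and k+1 exactly if q k = 0 and s k = k. Hence only the
    cell at the origin with the identity permutation contributes. *)
Lemma coordinate_flips : \xor_c flips coordinate_label c = true.
Proof.
pose c0 : cell := ([ffun=> Ordinal p_gt0], 1%g).
rewrite (bigD1 c0) //= big1 ?addbF.
  apply: big1 => k _; rewrite /coordinate_label valK /vertex /= ffunE perm1.
  by rewrite ltnn ltnSn.
move=> [q s] /negP qs; apply/negbTE/negP; rewrite /flips big_andE => /forallP /= cs.
apply: qs; have {cs} qs k : (q k == 0 :> nat) && (s k == k :> nat).
  have := cs k; rewrite /coordinate_label valK /vertex /= => /=.
  by rewrite !addn_gt0 ltnS; case: (ltngtP (s k) k) => _; case: (nat_of_ord (q k)).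
apply/eqP; congr pair.
  by apply/ffunP => i; rewrite ffunE; apply: val_inj; case/andP: (qs i) => /eqP.
by apply/permP => i; rewrite perm1; apply: val_inj; case/andP: (qs i) => _ /eqP.
Qed.

Theorem kuhn (f : label) : admissible f -> exists q : 'I_n -> 'I_p, forall k : 'I_n,
  exists x y : point, [/\ forall i, q i <= x i <= (q i).+1,
    forall i, q i <= y i <= (q i).+1, f k x = false & f k y = true].
Proof.
move=> fP.
(* Below j the labels are those of the coordinates. Raising j replaces one label at a time, which
   keeps the parity. *)
pose h j : label := fun k => if k < j then coordinate_label k else f k.
have hP j : admissible (h j).
  by move=> i x xp; rewrite /h; case: ifP => _; [exact: coordinate_label_admissible|exact: fP].
have hS j : j <= n -> \xor_c flips (h j) c = \xor_c flips f c.
  elim: j => [_|j IH jn]; first by [].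
  rewrite -IH; last exact: ltnW.
  have hh (k : nat) : k != j -> h j k = h j.+1 k.
    by move=> kj; rewrite /h ltnS [in RHS]leq_eqVlt (negbTE kj).
  have := flips_sum_replace (j := Ordinal jn) (hP j) (hP j.+1) hh.
  by case: (\big[_/_]_c _); case: (\big[_/_]_c _).
have : \xor_c flips f c = true.
  rewrite -(hS n) //; apply: etrans coordinate_flips; apply: eq_bigr => c _; apply: eq_bigr => k _.
  by rewrite /h ltn_ord.
have [/existsP[[q s] cf] _|nf] := boolP [exists c, flips f c]; last first.
  by rewrite big1 // => c _; apply/negbTE; move/existsPn: nf; apply.
exists q => k; move: cf; rewrite /flips big_andE => /forallP /(_ k).
have near j i : q i <= vertex (q, s) j i <= (q i).+1.
  by rewrite /vertex /=; case: (_ < j); rewrite ?addn0 ?addn1 leqnn leqnSn.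
case f1: (f _ _); case f2: (f _ _) => // _.
  by exists (vertex (q, s) k.+1), (vertex (q, s) k); split.
by exists (vertex (q, s) k), (vertex (q, s) k.+1); split.
Qed.

End Grid.
End Parity.

(** * Invariance of the boundary *)

Lemma rV_norm_le (R : realType) n (v : 'rV[R]_n) (e : R) : 0 <= e ->
  (`|v| <= e) <-> (forall i, `|v 0 i| <= e).
Proof.
move=> e0; rewrite {1}/Num.norm /= mx_normrE; split.
  by move=> /bigmax_leP[_ ve] i; exact: (ve (0, i)).
by move=> ve; apply/bigmax_leP; split => // -[i j] _; rewrite ord1.
Qed.

Lemma rV_norm_coord (R : realType) n (v : 'rV[R]_n) i : `|v 0 i| <= `|v|.
Proof. exact: (rV_norm_le v (normr_ge0 v)).1. Qed.

Lemma rV_norm1_coord (R : realType) n (v : 'rV[R]_n) i : `|v 0 i| = 1 ->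
  (forall j, `|v 0 j| <= 1) -> `|v| = 1.
Proof.
move=> vi vle; apply/eqP; rewrite eq_le (rV_norm_le _ _).2 //=.
by rewrite -vi rV_norm_coord.
Qed.

(* The signs of the coordinates of [F] on a fine grid form a Kuhn labelling. *)
Lemma cube_zero (R : realType) N (F : 'rV[R]_N.+1 -> 'rV[R]_N.+1) (r : R) :
  0 < r -> {within [set v : 'rV[R]_N.+1 | `|v| <= 1], continuous F} ->
  (forall v, `|v| = 1 -> F v = r *: v) -> exists2 v, `|v| <= 1 & F v = 0.
Proof.
move=> r0 cF Fr; set D := [set v : 'rV[R]_N.+1 | `|v| <= 1].
(* Points of a grid of mesh 2 / (p + 1) in the cube [-1, 1]^(N+1). *)
pose g p (x : 'I_N.+1 -> nat) : 'rV[R]_N.+1 := \row_i (-1 + 2 * (x i)%:R / p.+1%:R).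
have gle p x : (forall i, (x i <= p.+1)%N) -> forall i, `|g p x 0 i| <= 1.
  move=> xp i; rewrite mxE ler_norml; have p0 : 0 < p.+1%:R :> R by rewrite ltr0n.
  rewrite lerDl divr_ge0 ?mulr_ge0 ?ler0n //= addrC lerBlDr ler_pdivrMr //.
  by rewrite -natrM -[1]/(1%:R) -natrD -natrM ler_nat leq_mul2l xp.
have gD p x : (forall i, (x i <= p.+1)%N) -> D (g p x).
  by move=> xp; apply/rV_norm_le => // i; exact: gle.
have gdist p x q : (forall i, (q i <= x i <= (q i).+1)%N) ->
    `|g p x - g p q| <= 2 / p.+1%:R.
  move=> xq; apply/rV_norm_le => [|i]; first by rewrite divr_ge0 ?ler0n.
  rewrite !mxE opprD addrACA subrr add0r -mulrBl -mulrBr normrM ger0_norm; last first.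
    by rewrite mulr_ge0 // subr_ge0 ler_nat; case/andP: (xq i).
  rewrite ger0_norm ?invr_ge0 ?ler0n // ler_pM2r ?invr_gt0 ?ltr0n //.
  rewrite ler_piMr // lerBlDr -[1]/(1%:R) -natrD ler_nat.
  by case/andP: (xq i) => _; rewrite add1n.
have step p : exists a : 'rV[R]_N.+1, D a /\ forall k, exists x y,
   [/\ D x /\ `|x - a| <= 2 / p.+1%:R, D y /\ `|y - a| <= 2 / p.+1%:R,
    F x 0 k <= 0 & 0 < F y 0 k].
  pose f (k : nat) (x : 'I_N.+1 -> nat) : bool :=
    if insub k is Some i then 0 < F (g p x) 0 i else true.
  (* On the boundary of the cube F v = r v with r > 0, so coordinate i of F is negative on the face
     -1 and positive on the face 1. *)
  have fP : admissible p.+1 f.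
    move=> i x xp; rewrite /f valK; have xP := gle p x xp.
    have gi : g p x 0 i = -1 + 2 * (x i)%:R / p.+1%:R by rewrite mxE.
    split=> xi; rewrite xi in gi.
      have g0 : g p x 0 i = -1 by rewrite gi mulr0 mul0r addr0.
      rewrite Fr; last by apply: (@rV_norm1_coord _ _ _ i) => //; rewrite g0 normrN1.
      by rewrite mxE g0 mulrN1 oppr_gt0 ltNge ltW.
    have g1 : g p x 0 i = 1 by rewrite gi mulfK ?pnatr_eq0 //; lra.
    rewrite Fr; last by apply: (@rV_norm1_coord _ _ _ i) => //; rewrite g1 normr1.
    by rewrite mxE g1 mulr1.
  have [q qP] := kuhn (ltn0Sn p) fP.
  have qp i : (q i <= p.+1)%N by exact: ltnW.
  exists (g p q); split; first exact: gD.
  move=> k; have [x [y [xq yq]]] := qP k; rewrite /f valK => fx fy.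
  exists (g p x), (g p y).
  have Dg z : (forall i, (q i <= z i <= (q i).+1)%N) -> D (g p z).
    move=> zq; apply: gD => i; case/andP: (zq i) => _ /leq_trans; apply; exact: ltn_ord.
  split=> //; [by split; [exact: Dg|exact: gdist]|by split; [exact: Dg|exact: gdist]|].
  by rewrite leNgt fx.
have [a aP] := choice step.
have Dco : compact D.
  apply: bounded_closed_compact.
    by exists 1; split => // x x1 v /= /le_trans; apply; exact: ltW.
  rewrite (_ : D = closed_ball_ Num.norm (0 : 'rV[R]_N.+1) 1).
    exact: closed_closed_ball_.
  by apply/seteqP; split=> v; rewrite /closed_ball_ /D /= sub0r normrN.
(* A cluster point of the shrinking cells is a zero: if [F b 0 k] were nonzero, this coordinate
   would keep its sign near b, whereas every cell has points with [F x 0 k <= 0] and with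
   [0 < F y 0 k]. *)
have [b [Db bcl]] : D `&` cluster (a @ \oo) !=set0.
  by apply: Dco; exists 0%N => // p _ /=; have [] := aP p.
exists b => //; apply/rowP => k; rewrite [RHS]mxE; apply/eqP/negP => /negP Fb0.
have Fk : {within D, continuous (fun v => F v 0 k)}.
  apply: (@within_continuous_comp _ _ _ D F (fun v => v 0 k)) => // v _.
  exact: coord_continuous.
have := Fk; rewrite subspace_continuousP => /(_ b Db).
move/cvgrPdist_lt => /(_ `|F b 0 k|); rewrite normr_gt0 => /(_ Fb0).
rewrite near_withinE /= => /nbhs_ballP[e /= e0 eP].
have sgn z : D z -> `|z - b| < e -> 0 < F z 0 k * F b 0 k.
  move=> Dz zb; have := eP z; rewrite -ball_normE /= distrC => /(_ zb Dz).
  rewrite /from_subspace ltr_norml => /andP[].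
  case: (ltrgt0P (F b 0 k)) Fb0 => // w0 _ l1 l2.
    by rewrite mulr_gt0 //; lra.
  by rewrite nmulr_lgt0 //; lra.
have big : (a @ \oo) (fun v => exists2 p, 2 / p.+1%:R < e / 2 & v = a p).
  have : \forall p \near \oo, 2 / p.+1%:R < e / 2.
    have e4 : 0 < e / 4 by rewrite divr_gt0.
    near=> p; have : p.+1%:R^-1 < e / 4.
      by near: p; exact: (near_infty_natSinv_lt (PosNum e4)).
    by move: (p.+1%:R^-1) => x; lra.
  by case=> M _ Hp; exists M => // p Mp; exists p => //; exact: Hp.
have [_ [[p pe ->]]] := bcl _ _ big (nbhsx_ballx b (e / 2) (divr_gt0 e0 (ltr0Sn R 1))).
rewrite -ball_normE /= => ab.
have [_ /(_ k) [x [y [[Dx xa] [Dy ya] Fx Fy]]]] := aP p.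
have near z : D z -> `|z - a p| <= 2 / p.+1%:R -> `|z - b| < e.
  move=> Dz za; rewrite -(subrKA (a p)) (le_lt_trans (ler_normD _ _)) //.
  by rewrite [e]splitr ltrD // ?(le_lt_trans za) // distrC.
have := sgn x Dx (near x Dx xa); have := sgn y Dy (near y Dy ya).
nra.
Unshelve. all: by end_near. Qed.

(** * Continuity on a subset and at a point, following the shape of a formula *)

Lemma within_comp (X Y Z : topologicalType) (A : set X) (B : set Y)
    (f : X -> Y) (g : Y -> Z) :
  (forall x, A x -> B (f x)) -> {within A, continuous f} ->
  {within B, continuous g} -> {within A, continuous (g \o f)}.
Proof.
move=> AB cf cg; apply/subspace_continuousP => x Ax.
move/subspace_continuousP : cf => /(_ x Ax) cf.
move/subspace_continuousP : cg => /(_ _ (AB _ Ax)) cg.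
apply: cvg_comp cg => U; rewrite /within /= => /cf; rewrite /within /= /nbhs /=.
rewrite /within /= => cfU; near=> y.
by move=> Ay; apply: (near cfU y) => //; exact: AB.
Unshelve. all: by end_near. Qed.

Lemma within_open_for (X Y : topologicalType) (A : set X) (f : X -> Y) x :
  open A -> {within A, continuous f} -> A x -> {for x, continuous f}.
Proof.
by move=> oA; rewrite continuous_open_subspace // => cf Ax; apply: cf; rewrite inE.
Qed.

Section ContinuousFor.
Variables (K : numFieldType) (V : normedModType K) (T : topologicalType) (x : T).

Lemma for_cst (U : topologicalType) (a : U) : {for x, continuous (fun=> a)}.
Proof. exact: cvg_cst. Qed.

Lemma for_id : {for x, continuous (fun y : T => y)}.
Proof. exact: cvg_id. Qed.

Lemma for_comp (U W : topologicalType) (f : T -> U) (g : U -> W) :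
  {for x, continuous f} -> {for f x, continuous g} ->
  {for x, continuous (fun y => g (f y))}.
Proof. exact: continuous_comp. Qed.

Lemma for_add (f g : T -> V) : {for x, continuous f} -> {for x, continuous g} ->
  {for x, continuous (fun y => f y + g y)}.
Proof. exact: continuousD. Qed.

Lemma for_opp (f : T -> V) : {for x, continuous f} ->
  {for x, continuous (fun y => - f y)}.
Proof. exact: continuousN. Qed.

Lemma for_scale (s : T -> K) (f : T -> V) :
  {for x, continuous s} -> {for x, continuous f} ->
  {for x, continuous (fun y => s y *: f y)}.
Proof. exact: continuousZ. Qed.

Lemma for_mul (f g : T -> K) : {for x, continuous f} -> {for x, continuous g} ->
  {for x, continuous (fun y => f y * g y)}.
Proof. exact: continuousM. Qed.

Lemma for_inv (f : T -> K) : f x != 0 -> {for x, continuous f} ->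
  {for x, continuous (fun y => (f y)^-1)}.
Proof. exact: cvgV. Qed.

Lemma for_norm (f : T -> V) : {for x, continuous f} ->
  {for x, continuous (fun y => `|f y|)}.
Proof. exact: cvg_norm. Qed.

End ContinuousFor.

Section ChartTheory.
Variables (R : realType) (n : nat) (M : topologicalType).

Lemma chart_invK (H : set 'rV[R]_n) (c : chart H M) v :
  (chart_map c @` chart_dom c) v ->
  chart_dom c (chart_inv c v) /\ chart_map c (chart_inv c v) = v.
Proof. by move=> [y cy <-]; rewrite chart_mapK. Qed.

Lemma chart_map_for (H : set 'rV[R]_n) (c : chart H M) x :
  chart_dom c x -> {for x, continuous (chart_map c)}.
Proof.
by move=> cx; apply: (within_open_for (chart_dom_open c)) => //; exact: chart_map_continuous.
Qed.

Lemma euclidean_image_open (e : chart (euclidean R n) M) :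
  open (chart_map e @` chart_dom e).
Proof. by have [V oV ->] := chart_image_open e; rewrite /euclidean setIT. Qed.

Lemma euclidean_inv_for (e : chart (euclidean R n) M) x :
  chart_dom e x -> {for chart_map e x, continuous (chart_inv e)}.
Proof.
move=> ex.
apply: (within_open_for (@euclidean_image_open e) (@chart_inv_continuous _ _ _ _ e)).
by exists x.
Qed.

End ChartTheory.

(* A punctured half-ball centred on the wall is star-shaped, whereas spheres
   around an interior point do not contract in a punctured ball. *)
Lemma interior_not_wall (R : realType) n (M : topologicalType)
    (e : chart (euclidean R n) M) (c : chart (half_space R n) M) (x : M) :
  chart_dom e x -> chart_dom c x -> ~ wall R n (chart_map c x).
Proof.
case: n e c => [|N] e c ex cx [i i0]; first by case: i i0.
rewrite (_ : i = ord0); last exact: val_inj.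
move=> {i i0}; set p := chart_map c x => p0; set a := chart_map e x.
pose C := chart_map c @` chart_dom c.
have eKa : chart_inv e a = x by rewrite chart_mapK.
have cKp : chart_inv c p = x by rewrite chart_mapK.
pose g := chart_map c \o chart_inv e.
have Cp : C p by exists x.
have [rho rho0 rhoP] : exists2 rho : R, 0 < rho & forall w, half_space R N.+1 w ->
    `|w - p| < rho -> C w /\ chart_dom e (chart_inv c w).
  have [V oV CV] := chart_image_open c.
  have Vp : nbhs p V by apply: open_nbhs_nbhs; split => //; move: Cp; rewrite /C CV => -[].
  have := @chart_inv_continuous _ _ _ _ c; rewrite subspace_continuousP => /(_ p Cp).
  rewrite /from_subspace cKp => /(_ _ (open_nbhs_nbhs (conj (chart_dom_open e) ex))).
  move=> near1.
  have {}near1 : nbhs p (fun y => C y -> chart_dom e (chart_inv c y)) by exact: near1.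
  have /nbhs_ballP[rho rho0 rhoP] : nbhs p (V `&` (fun y => C y -> chart_dom e (chart_inv c y))).
    exact: filterI.
  exists rho => // w Hw wp; have [Vw ew] : (V `&` (fun y => C y -> chart_dom e (chart_inv c y))) w.
    by apply: rhoP; rewrite -ball_normE /= distrC.
  have Cw : C w by rewrite /C CV.
  by split=> //; exact: ew.
have ce : {for a, continuous (chart_inv e)} by exact: euclidean_inv_for.
have gfor v : (chart_map e @` chart_dom e) v -> chart_dom c (chart_inv e v) ->
    {for v, continuous g}.
  move=> [y ey <-]; rewrite chart_mapK // => cy.
  apply: continuous_comp; first exact: euclidean_inv_for.
  by rewrite chart_mapK //; exact: chart_map_for.
have ga : g a = p by rewrite /g /= eKa.
have [r r0 rP] : exists2 r : R, 0 < r & forall v, `|v - a| <= r ->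
   [/\ (chart_map e @` chart_dom e) v, chart_dom c (chart_inv e v) & `|g v - p| < rho].
  have n1 : nbhs a (chart_map e @` chart_dom e).
    by apply: open_nbhs_nbhs; split; [exact: euclidean_image_open|exists x].
  have n2 : nbhs a (chart_inv e @^-1` chart_dom c).
    by apply: ce; apply: open_nbhs_nbhs; split; [exact: chart_dom_open|rewrite eKa].
  have n3 : nbhs a (g @^-1` (ball p rho)).
    by apply: gfor; [exists x|rewrite eKa|rewrite ga; exact: nbhsx_ballx].
  have /nbhs_ballP[d /= d0 dP] : nbhs a ((chart_map e @` chart_dom e) `&`
      ((chart_inv e @^-1` chart_dom c) `&` (g @^-1` (ball p rho)))).
    by apply: filterI => //; exact: filterI.
  exists (d / 2); first by rewrite divr_gt0.
  move=> v va; have [] : ((chart_map e @` chart_dom e) `&`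
      ((chart_inv e @^-1` chart_dom c) `&` (g @^-1` (ball p rho)))) v.
    by apply: dP; rewrite -ball_normE /= distrC; lra.
  move=> ? [? gv]; split => //.
  by move: gv; rewrite /= -ball_normE /= distrC.
(* The point q lies off the wall. [G] equals g (a + r v) on the unit sphere and is drawn towards q
   inside it; by convexity it stays in the half-ball, and for |v| < 1 it avoids the wall. *)
pose q := p + (rho / 2) *: delta_mx 0 ord0 : 'rV[R]_N.+1.
pose G (v : 'rV[R]_N.+1) := `|v| *: g (a + r *: v) + (1 - `|v|) *: q.
have arv v : `|v| <= 1 -> `|a + r *: v - a| <= r.
  by move=> v1; rewrite addrC addKr normrZ gtr0_norm // ler_piMr // ltW.
have qp : `|q - p| < rho.
  rewrite /q addrC addKr (@le_lt_trans _ _ (rho / 2)) //; last by lra.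
  apply/rV_norm_le => [|i]; first by lra.
  rewrite !mxE /= normrM gtr0_norm ?divr_gt0 //.
  by case: (i == _); rewrite ?normr0 ?normr1; lra.
have Gp v : `|v| <= 1 -> `|G v - p| < rho.
  move=> v1; have [_ _ gp] := rP _ (arv _ v1).
  have -> : G v - p = `|v| *: (g (a + r *: v) - p) + (1 - `|v|) *: (q - p).
    rewrite /G !scalerBr addrACA -opprD -scalerDl; congr (_ - _).
    by rewrite addrC subrK scale1r.
  apply: le_lt_trans (ler_normD _ _) _; rewrite !normrZ normr_id.
  have v0 := normr_ge0 v; rewrite (@ger0_norm _ (1 - _)) ?subr_ge0 //.
  move: v0 v1 gp qp; move: `|v| `|_ - p| `|q - p| => s A B.
  rewrite le_eqVlt => /predU1P[<- _ _ |s0 s1 Ar Br]; first by rewrite mul0r add0r subr0 mul1r.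
  have h1 : 0 < s * (rho - A) by rewrite mulr_gt0 ?subr_gt0.
  have h2 : 0 <= (1 - s) * (rho - B) by rewrite mulr_ge0 ?subr_ge0 // ltW.
  by lra.
have G0 v : `|v| <= 1 -> 0 <= G v 0 ord0 /\ (`|v| < 1 -> 0 < G v 0 ord0).
  move=> v1; have [ev cv _] := rP _ (arv _ v1).
  have gv : 0 <= g (a + r *: v) 0 ord0.
    have [V _ CV] := chart_image_open c.
    have : C (g (a + r *: v)) by exists (chart_inv e (a + r *: v)).
    by rewrite /C CV => -[_]; apply.
  rewrite /G /q !mxE eqxx mulr1 p0 add0r; have v0 := normr_ge0 v.
  move: v0 v1 gv; move: `|v| (g _ _ _) => s A s0 s1 A0; split; first by nra.
  move=> s1'; have h1 : 0 <= s * A by exact: mulr_ge0.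
  by have h2 : 0 < (1 - s) * rho; [rewrite mulr_gt0 ?subr_gt0|lra].
have GH v : `|v| <= 1 -> half_space R N.+1 (G v).
  by move=> v1 i i0; rewrite (_ : i = ord0); [exact: (G0 _ v1).1|exact: val_inj].
pose F (v : 'rV[R]_N.+1) := chart_map e (chart_inv c (G v)) - a.
have Fr v : `|v| = 1 -> F v = r *: v.
  move=> v1; have v1' : `|v| <= 1 by rewrite v1.
  have [[y ey yE] cv _] := rP _ (arv _ v1').
  rewrite /F /G v1 subrr scale0r addr0 scale1r /g /= chart_mapK //.
  by rewrite -yE chart_mapK // yE addrC addKr.
have cF : {within [set v : 'rV[R]_N.+1 | `|v| <= 1], continuous F}.
  have cG : {within [set v : 'rV[R]_N.+1 | `|v| <= 1], continuous G}.
    apply: continuous_in_subspaceT => v; rewrite inE /= => v1.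
    have [ev cv _] := rP _ (arv _ v1).
    pose V := 'rV[R]_N.+1; have cn : {for v, continuous (fun y : V => `|y|)}.
      exact: (@for_norm R V V v id (@for_id _ _)).
    apply: (@for_add R V V v); apply: (@for_scale R V V v) => //.
    - apply: (@for_comp V v V V (fun y => a + r *: y) g); last exact: gfor.
      apply: (@for_add R V V v); first exact: for_cst.
      by apply: (@for_scale R V V v); [exact: for_cst|exact: for_id].
    - apply: (@for_add R R^o V v); first exact: for_cst.
      exact: (@for_opp R R^o V v).
    - exact: for_cst.
  have c1 := within_comp (fun v v1 => (rhoP _ (GH v v1) (Gp v v1)).1) cG
    (@chart_inv_continuous _ _ _ _ c).
  have c2 := within_comp (B := chart_dom e) (fun v v1 => (rhoP _ (GH v v1) (Gp v v1)).2) c1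
    (@chart_map_continuous _ _ _ _ e).
  by move=> v; apply: cvgB; [exact: c2|exact: cvg_cst].
(* At this zero [G v] is p, a point of the wall, so |v| = 1; but there F v = r v is nonzero. *)
have [v v1 Fv] := cube_zero r0 cF Fr.
have [CG eG] := rhoP _ (GH v v1) (Gp v v1).
have GE : G v = p.
  have [_ <-] := chart_invK CG.
  move/eqP: Fv; rewrite subr_eq0 => /eqP Fv.
  by rewrite -(chart_mapK (x := chart_inv c (G v)) eG) Fv eKa.
have vn1 : `|v| = 1.
  apply/eqP; rewrite eq_le v1 leNgt; apply/negP => /((G0 v v1).2).
  by rewrite GE p0 ltxx.
move: Fv; rewrite Fr // => /eqP; rewrite scaler_eq0 gt_eqF //= => /eqP v0.
by move/eqP: vn1; rewrite v0 normr0 eq_sym oner_eq0.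
Qed.

(** * Complex vectors and the antilinear involution *)

Section MatrixContinuity.
Variables (T U : topologicalType) (m n : nat).

Lemma for_mx (f : T -> 'M[U]_(m, n)) x :
  (forall i j, {for x, continuous (fun y => f y i j)}) -> {for x, continuous f}.
Proof.
move=> cf A [P nP PA].
have : \forall y \near x, forall i j, P i j (f y i j).
  apply: filter_forall => i; apply: filter_forall => j; exact: (cf i j _ (nP i j)).
by apply: filterS => y Py; apply: PA.
Qed.

Lemma for_coord (f : T -> 'M[U]_(m, n)) x i j :
  {for x, continuous f} -> {for x, continuous (fun y => f y i j)}.
Proof.
move=> cf A nA.
suff nB : nbhs (f x) (fun M => A (M i j)) by exact: (cf _ nB).
exists (fun i' j' => if (i' == i) && (j' == j) then A else setT).
  by move=> i' j'; case: ifP => [/andP[/eqP-> /eqP->] //|_]; exact: filterT.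
by move=> M /(_ i j); rewrite !eqxx.
Qed.

End MatrixContinuity.

Section ComplexContinuity.
Variables (R : realType) (T : topologicalType) (x : T).
Local Notation C := (R[i]^o : topologicalType).


Lemma normc_le (a b : R) : `|(a +i* b)%C| <= (`|a| + `|b|)%:C%C.
Proof.
rewrite normc_def lecR /= -[leRHS]ger0_norm ?addr_ge0 // -sqrtr_sqr ler_wsqrtr //.
rewrite sqrrD !real_normK ?num_real //. rewrite [leRHS]addrAC lerDl.
exact: (mulrn_wge0 2 (mulr_ge0 (normr_ge0 a) (normr_ge0 b))).
Qed.

Lemma for_complex (f g : T -> R) :
  {for x, continuous f} -> {for x, continuous g} ->
  {for x, continuous ((fun y => (f y +i* g y)%C) : T -> R[i]^o)}.
Proof.
move=> cf cg; apply/cvgrPdist_lt => -[e e']; rewrite ltcE /= => /andP[/eqP -> e0].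
have e2 : 0 < e / 2 by rewrite divr_gt0.
move/cvgrPdist_lt: cf => /(_ _ e2) cf; move/cvgrPdist_lt: cg => /(_ _ e2) cg.
near=> y; apply: le_lt_trans (normc_le _ _) _.
rewrite ltcR [e]splitr ltrD //; near: y; [exact: cf|exact: cg].
Unshelve. all: by end_near. Qed.

Lemma for_Re (f : T -> R[i]^o) :
  {for x, continuous f} -> {for x, continuous (fun y => complex.Re (f y) : R)}.
Proof.
move=> cf; apply/cvgrPdist_lt => e e0; move/cvgrPdist_lt: cf => /(_ (e%:C)%C).
rewrite ltcR => /(_ e0); apply: filterS => y fy; rewrite -ltcR.
by apply: le_lt_trans fy; rewrite -raddfB normc_ge_Re.
Qed.

Lemma for_Im (f : T -> R[i]^o) :
  {for x, continuous f} -> {for x, continuous (fun y => complex.Im (f y) : R)}.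
Proof.
move=> cf; suff : {for x, continuous (fun y => complex.Re (- ('i%C * f y)) : R)}.
  congr {for _, continuous _}; apply/funext => t; apply/funext => y.
  by case: (f y) => a b /=; rewrite mul0r mul1r add0r opprK.
apply: for_Re; apply: (@for_opp R[i] R[i]^o T x).
by apply: (@for_mul R[i] T x); first exact: for_cst.
Qed.

End ComplexContinuity.

Section SquaredNorm.
Variable R : realType.
Local Notation C := (R[i]^o).

(** The squared modulus as an element of [R]; the norm of [R[i]] takes its values in [R[i]]. *)
Definition nsq (c : C) : R := complex.Re c ^+ 2 + complex.Im c ^+ 2.

Lemma nsq_ge0 c : 0 <= nsq c.
Proof. by rewrite addr_ge0 ?sqr_ge0. Qed.

Lemma nsqM c d : nsq (c * d) = nsq c * nsq d.
Proof. by case: c => a b; case: d => a' b'; rewrite /nsq /=; ring. Qed.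

Lemma nsq_eq0 c : (nsq c == 0) = (c == 0).
Proof.
case: c => a b; rewrite /nsq paddr_eq0 ?sqr_ge0 // !sqrf_eq0 /=.
by rewrite eq_complex.
Qed.

Lemma nsq_gt0 c : (0 < nsq c) = (c != 0).
Proof. by rewrite lt_neqAle nsq_ge0 andbT eq_sym nsq_eq0. Qed.

Lemma nsqN c : nsq (- c) = nsq c.
Proof. by case: c => a b; rewrite /nsq /= !sqrrN. Qed.

Lemma nsq_conj (c : C) : nsq (conjc c) = nsq c.
Proof. by case: c => a b; rewrite /nsq /= sqrrN. Qed.

Lemma nsqE (c : C) : (nsq c)%:C%C = c * conjc c.
Proof.
by case: c => a b; apply/eqP; rewrite eq_complex /nsq /=; apply/andP; split;
  apply/eqP; ring.
Qed.

Lemma for_nsq (T : topologicalType) (x : T) (f : T -> C) :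
  {for x, continuous f} -> {for x, continuous (fun y => nsq (f y))}.
Proof.
move=> cf; apply: (@for_add R R^o T x).
  by apply: (@for_mul R T x); exact: for_Re.
by apply: (@for_mul R T x); exact: for_Im.
Qed.

End SquaredNorm.

Section Antilinear.
Variables (R : realType) (m : nat) (J : 'M[R]_m.+1).
Hypotheses (JT : J^T = - J) (JJ : J *m J = - 1%:M).
Local Notation C := (R[i]^o).
Local Notation E := 'rV[C]_m.+1.

Definition conj_row n (z : 'rV[C]_n) : 'rV[C]_n := map_mx (@conjc R) z.
Definition complexify : 'M[C]_m.+1 := map_mx (@real_complex R) J.
Definition tau (z : E) : E := conj_row z *m complexify.

Lemma conj_rowK n : involutive (@conj_row n).
Proof. by move=> z; apply/rowP => i; rewrite !mxE conjcK. Qed.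

Lemma conj_rowZ n (c : C) (z : 'rV[C]_n) : conj_row (c *: z) = conjc c *: conj_row z.
Proof. by apply/rowP => i; rewrite !mxE rmorphM. Qed.

Lemma tauZ (c : C) z : tau (c *: z) = conjc c *: tau z.
Proof. by rewrite /tau conj_rowZ scalemxAl. Qed.

Lemma complexify2 : complexify *m complexify = - 1%:M.
Proof. by rewrite -map_mxM JJ map_mxN map_mx1. Qed.

Lemma conj_complexify (z : E) : conj_row (z *m complexify) = conj_row z *m complexify.
Proof.
rewrite /conj_row map_mxM; congr (_ *m _).
by apply/matrixP => i j; rewrite mxE [in RHS]mxE [in LHS]mxE; exact: conjc_real.
Qed.

Lemma tauK z : tau (tau z) = - z.
Proof. by rewrite /tau conj_complexify conj_rowK -mulmxA complexify2 mulmxN mulmx1. Qed.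

Lemma tau0 : tau 0 = 0.
Proof. by rewrite /tau /conj_row map_mx0 mul0mx. Qed.

Lemma tau_eq0 z : (tau z == 0) = (z == 0).
Proof.
apply/eqP/eqP => [z0|->]; last exact: tau0.
by apply: oppr_inj; rewrite -tauK z0 tau0 oppr0.
Qed.

Definition dot (z p : E) : C := \sum_a z 0 a * conjc (p 0 a).

Lemma dotZ c z p : dot (c *: z) p = c * dot z p.
Proof. by rewrite /dot mulr_sumr; apply: eq_bigr => a _; rewrite mxE mulrA. Qed.

Lemma dotN z p : dot (- z) p = - dot z p.
Proof. by rewrite -scaleN1r dotZ mulN1r. Qed.

Lemma dotzz z : dot z z = (\sum_a nsq (z 0 a))%:C%C.
Proof. by rewrite raddf_sum; apply: eq_bigr => a _; rewrite -nsqE. Qed.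

(** This is conj z J (conj z)^T, the value of an alternating form on twice the same vector;
    transposition turns it into its negative. So [tau z] is Hermitian-orthogonal to z. *)
Lemma dot_tau z : dot (tau z) z = 0.
Proof.
have e : dot (tau z) z = (tau z *m (conj_row z)^T) 0 0.
  by rewrite !mxE; apply: eq_bigr => a _; rewrite !mxE.
have : (tau z *m (conj_row z)^T) 0 0 = - (tau z *m (conj_row z)^T) 0 0.
  rewrite -[in LHS](trmxK (tau z *m _)) [in LHS]mxE /tau !trmx_mul trmxK.
  rewrite (_ : complexify^T = - complexify); last first.
    by rewrite /complexify map_trmx JT map_mxN.
  by rewrite mulmxA mulmxN mulNmx !mxE.
rewrite -e => /eqP; rewrite -subr_eq0 opprK -mulr2n mulrn_eq0 /=.
by move/eqP.
Qed.

(* Its sign tells the representatives [z] and [tau z] apart. *)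
Definition sheet (p z : E) : R := nsq (dot z p) - nsq (dot (tau z) p).

Lemma sheetZ p c z : sheet p (c *: z) = nsq c * sheet p z.
Proof. by rewrite /sheet tauZ !dotZ !nsqM nsq_conj mulrBr. Qed.

Lemma sheet_tau p z : sheet p (tau z) = - sheet p z.
Proof. by rewrite /sheet tauK dotN nsqN opprB. Qed.

(** At p = z the second term of [sheet] vanishes by [dot_tau]. Hence taking p to be the point itself
    always yields a sheet that contains it. *)
Lemma sheet_diag z : z != 0 -> 0 < sheet z z.
Proof.
move=> z0; rewrite /sheet dot_tau dotzz /nsq /= !expr0n /= !addr0 subr0.
rewrite exprn_gt0 // lt_neqAle sumr_ge0 => [|a _]; last exact: nsq_ge0.
rewrite andbT eq_sym psumr_neq0 => [|a _]; last exact: nsq_ge0.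
have /rV0Pn[a za] := z0.
by apply/hasP; exists a; rewrite ?mem_index_enum // nsq_gt0.
Qed.

End Antilinear.

(** * Affine coordinates on projective space and real coordinates on R x C^m *)

Section Affine.
Variables (R : realType) (m : nat).
Local Notation C := (R[i]^o).
Local Notation E := 'rV[C]_m.+1.

Definition ins (i : 'I_m.+1) (u : 'rV[C]_m) : E :=
  \row_a if unlift i a is Some l then u 0 l else 1.

Definition aff (i : 'I_m.+1) (z : E) : 'rV[C]_m := \row_l (z 0 (lift i l) / z 0 i).

Lemma ins_self i u : ins i u 0 i = 1.
Proof. by rewrite mxE unlift_none. Qed.

Lemma ins_lift i u l : ins i u 0 (lift i l) = u 0 l.
Proof. by rewrite mxE liftK. Qed.

Lemma ins_neq0 i u : ins i u != 0.
Proof. by apply/eqP => /rowP/(_ i)/eqP; rewrite ins_self mxE oner_eq0. Qed.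

Lemma aff_ins i u : aff i (ins i u) = u.
Proof. by apply/rowP => l; rewrite mxE ins_lift ins_self divr1. Qed.

Lemma ins_aff i (z : E) : z 0 i != 0 -> ins i (aff i z) = (z 0 i)^-1 *: z.
Proof.
move=> zi; apply/rowP => a; case: (unliftP i a) => [l|] ->.
  by rewrite ins_lift !mxE mulrC.
by rewrite ins_self mxE mulVf.
Qed.

Lemma affZ i c z : c != 0 -> aff i (c *: z) = aff i z.
Proof. by move=> c0; apply/rowP => l; rewrite !mxE -mulf_div divff // mul1r. Qed.

Lemma conj_ins i u : conj_row (ins i u) = ins i (conj_row u).
Proof.
apply/rowP => a; case: (unliftP i a) => [l|] ->.
  by rewrite mxE !ins_lift mxE.
by rewrite mxE !ins_self; apply/eqP; rewrite eq_complex /= oppr0 !eqxx.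
Qed.

Lemma for_ins (T : topologicalType) (x : T) i (f : T -> 'rV[C]_m) :
  {for x, continuous f} -> {for x, continuous (fun y => ins i (f y))}.
Proof.
move=> cf; apply: for_mx => b a; rewrite ord1; case: (unliftP i a) => [l|] ->.
  rewrite (_ : (fun _ => _) = fun y => f y 0 l); first exact: for_coord.
  by apply/funext => y; rewrite ins_lift.
rewrite (_ : (fun _ => _) = fun=> 1); first exact: for_cst.
by apply/funext => y; rewrite ins_self.
Qed.

Lemma for_aff (T : topologicalType) (x : T) i (f : T -> E) : f x 0 i != 0 ->
  {for x, continuous f} -> {for x, continuous (fun y => aff i (f y))}.
Proof.
move=> fi cf; apply: for_mx => b l; rewrite ord1.
rewrite (_ : (fun _ => _) = fun y => f y 0 (lift i l) / f y 0 i); last first.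
  by apply/funext => y; rewrite mxE.
apply: (@for_mul R[i] T x); first exact: for_coord.
by apply: (@for_inv R[i] T x) => //; exact: for_coord.
Qed.

(* R x C^m as a real coordinate space: the real coordinate and the imaginary
   parts come first, so that negating them all is [-1] on R^(m+1). *)
Definition enc (t : R) (u : 'rV[C]_m) : 'rV[R]_(m.+1 + m) :=
  row_mx (\row_a if unlift ord0 a is Some l then complex.Im (u 0 l) else t)
         (\row_l complex.Re (u 0 l)).

Definition dec_t (v : 'rV[R]_(m.+1 + m)) : R := v 0 (lshift m ord0).

Definition dec_u (v : 'rV[R]_(m.+1 + m)) : 'rV[C]_m :=
  \row_l (v 0 (rshift m.+1 l) +i* v 0 (lshift m (lift ord0 l)))%C.

Lemma enc_t t u : dec_t (enc t u) = t.
Proof. by rewrite /dec_t /enc row_mxEl mxE unlift_none. Qed.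

Lemma enc_u t u : dec_u (enc t u) = u.
Proof.
apply/rowP => l; rewrite /dec_u /enc mxE row_mxEr row_mxEl !mxE liftK.
by case: (u 0 l).
Qed.

Lemma encK v : enc (dec_t v) (dec_u v) = v.
Proof.
apply/rowP => k; rewrite /enc; case: (split_ordP k) => a ->.
  rewrite row_mxEl mxE; case: (unliftP ord0 a) => [l|] -> //.
  by rewrite /dec_u mxE.
by rewrite row_mxEr !mxE.
Qed.

Lemma enc_eq0 t u : (enc t u == 0) = (t == 0) && (u == 0).
Proof.
apply/eqP/andP => [e|[/eqP-> /eqP->]].
  split; first by rewrite -(enc_t t u) e /dec_t mxE.
  by apply/eqP; rewrite -(enc_u t u) e; apply/rowP => l; rewrite !mxE.
apply/rowP => k; rewrite /enc; case: (split_ordP k) => a ->.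
  by rewrite row_mxEl !mxE; case: unlift => // l; rewrite mxE.
by rewrite row_mxEr !mxE.
Qed.

Lemma dec_tD v w : dec_t (v + w) = dec_t v + dec_t w.
Proof. by rewrite /dec_t mxE. Qed.

Lemma dec_uD v w : dec_u (v + w) = dec_u v + dec_u w.
Proof. by apply/rowP => l; rewrite !mxE. Qed.

Lemma dec_tZ r v : dec_t (r *: v) = r * dec_t v.
Proof. by rewrite /dec_t mxE. Qed.

Lemma dec_uZ r v : dec_u (r *: v) = (r%:C%C : C) *: dec_u v.
Proof. by apply/rowP => l; rewrite !mxE; apply/eqP; rewrite eq_complex /= !mul0r subr0 addr0 !eqxx. Qed.

Lemma encB t u t' u' : enc t u - enc t' u' = enc (t - t') (u - u').
Proof.
apply/rowP => k; rewrite [LHS]mxE [X in _ + X]mxE /enc; case: (split_ordP k) => a ->.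
  by rewrite !row_mxEl !mxE; case: unlift => [l|//]; rewrite !mxE raddfB.
by rewrite !row_mxEr !mxE raddfB.
Qed.

Section EncContinuity.
Variables (T : topologicalType) (x : T).

Lemma for_enc (f : T -> R) (g : T -> 'rV[C]_m) : {for x, continuous f} ->
  {for x, continuous g} -> {for x, continuous (fun y => enc (f y) (g y))}.
Proof.
move=> cf cg; apply: for_mx => b k; rewrite ord1 /enc; case: (split_ordP k) => a ->.
  case: (unliftP ord0 a) => [l|] ->.
    rewrite (_ : (fun _ => _) = fun y => complex.Im (g y 0 l)).
      by apply: for_Im; exact: for_coord.
    by apply/funext => y; rewrite row_mxEl mxE liftK.
  rewrite (_ : (fun _ => _) = f) //.
  by apply/funext => y; rewrite row_mxEl mxE unlift_none.
rewrite (_ : (fun _ => _) = fun y => complex.Re (g y 0 a)).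
  by apply: for_Re; exact: for_coord.
by apply/funext => y; rewrite row_mxEr mxE.
Qed.

Lemma for_dec_t (f : T -> 'rV[R]_(m.+1 + m)) : {for x, continuous f} ->
  {for x, continuous (fun y => dec_t (f y))}.
Proof. by move=> cf; exact: for_coord. Qed.

Lemma for_dec_u (f : T -> 'rV[R]_(m.+1 + m)) : {for x, continuous f} ->
  {for x, continuous (fun y => dec_u (f y))}.
Proof.
move=> cf; apply: for_mx => b l; rewrite ord1 /dec_u.
rewrite (_ : (fun _ => _) =
  (fun y => (f y 0 (rshift m.+1 l) +i* f y 0 (lshift m (lift ord0 l)))%C)).
  by apply: for_complex; exact: for_coord.
by apply/funext => y; rewrite mxE.
Qed.

End EncContinuity.

End Affine.

Section Sums.
Variables (R : realType) (m : nat) (J : 'M[R]_m.+1) (T : topologicalType) (x : T).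
Local Notation C := (R[i]^o).
Local Notation E := 'rV[C]_m.+1.

Lemma for_sum (K : numFieldType) (I : finType) (f : I -> T -> K) :
  (forall i, {for x, continuous (f i)}) ->
  {for x, continuous (fun y => \sum_i f i y)}.
Proof.
move=> cf; suff c s : {for x, continuous (fun y => \sum_(i <- s) f i y)}.
  exact: c.
elim: s => [|i s IH].
  rewrite (_ : (fun _ => _) = fun=> 0); first exact: for_cst.
  by apply/funext => y; rewrite big_nil.
rewrite (_ : (fun _ => _) = fun y => f i y + \sum_(i <- s) f i y).
  exact: (@for_add K K^o T x).
by apply/funext => y; rewrite big_cons.
Qed.

Lemma for_conj n (f : T -> 'rV[C]_n) : {for x, continuous f} ->
  {for x, continuous (fun y => conj_row (f y))}.
Proof.
move=> cf; apply: for_mx => b l; rewrite ord1.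
have cl : {for x, continuous (fun y => f y 0 l)} by exact: for_coord.
rewrite (_ : (fun _ => _) = fun y => (complex.Re (f y 0 l) +i* (- complex.Im (f y 0 l)))%C).
  apply: for_complex; first exact: for_Re.
  by apply: (@for_opp R R^o T x); exact: for_Im.
by apply/funext => y; rewrite mxE; case: (f y 0 l).
Qed.

Lemma for_mulmx n p (M : 'M[C]_(n, p)) (f : T -> 'rV[C]_n) : {for x, continuous f} ->
  {for x, continuous (fun y => f y *m M)}.
Proof.
move=> cf; apply: for_mx => b l; rewrite ord1.
rewrite (_ : (fun _ => _) = fun y => \sum_k f y 0 k * M k l); last first.
  by apply/funext => y; rewrite mxE.
apply: (@for_sum R[i]) => k.
by apply: (@for_mul R[i] T x); [exact: for_coord|exact: for_cst].
Qed.

Lemma for_tau (f : T -> E) : {for x, continuous f} ->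
  {for x, continuous (fun y => tau J (f y))}.
Proof. by move=> cf; apply: for_mulmx; exact: for_conj. Qed.

Lemma for_dot p (f : T -> E) : {for x, continuous f} ->
  {for x, continuous ((fun y => dot (f y) p) : T -> C)}.
Proof.
move=> cf; apply: (@for_sum R[i]) => k.
by apply: (@for_mul R[i] T x); [exact: for_coord|exact: for_cst].
Qed.

Lemma for_sheet p (f : T -> E) : {for x, continuous f} ->
  {for x, continuous (fun y => sheet J p (f y))}.
Proof.
move=> cf; apply: (@for_add R R^o T x).
  by apply: for_nsq; exact: for_dot.
apply: (@for_opp R R^o T x); apply: for_nsq; apply: for_dot; exact: for_tau.
Qed.

End Sums.

Section Clamp.
Variable R : realType.

(** The retraction of R onto [-1, 1]. It commutes with t -> - t, so heights may range over all of R
    and be compared through it. *)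
Definition clamp (t : R) : R := Num.max (-1) (Num.min 1 t).

Lemma clamp_ge t : -1 <= clamp t.
Proof. by rewrite le_max lexx. Qed.

Lemma clamp_le t : clamp t <= 1.
Proof. by rewrite /clamp ge_max ge_min lexx /= andbT; lra. Qed.

Lemma clamp_id t : -1 <= t <= 1 -> clamp t = t.
Proof. by move=> /andP[t0 t1]; rewrite /clamp (min_idPr t1); apply/max_idPr. Qed.

Lemma clampK t : clamp (clamp t) = clamp t.
Proof. by rewrite clamp_id // clamp_ge clamp_le. Qed.

Lemma clampN t : clamp (- t) = - clamp t.
Proof.
rewrite /clamp; case: (lerP 1 t) => t1; case: (lerP 1 (- t)) => t2;
  by rewrite /Num.max /Num.min; repeat case: ifP => ?; lra.
Qed.

Lemma for_clamp (T : topologicalType) (x : T) (f : T -> R) :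
  {for x, continuous f} -> {for x, continuous (fun y => clamp (f y))}.
Proof.
move=> cf; rewrite /clamp; apply: continuous_max; first exact: for_cst.
by apply: continuous_min; first exact: for_cst.
Qed.

End Clamp.

Lemma for_open (T U : topologicalType) (N : set T) (f : T -> U) (O : set U) :
  open N -> open O -> (forall x, N x -> {for x, continuous f}) ->
  open (N `&` f @^-1` O).
Proof.
move=> oN oO cf; rewrite openE => x [Nx fx]; apply: filterI.
  exact: open_nbhs_nbhs.
by apply: (cf x Nx); exact: open_nbhs_nbhs.
Qed.

Lemma continuous_open (T U : topologicalType) (f : T -> U) (O : set U) :
  continuous f -> open O -> open (f @^-1` O).
Proof. by move=> /continuousP cf oO; exact: cf. Qed.

(* Every class that meets [N] has all its representatives in [N] or in the
   preimage of [N] under [sigma]. *)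
Section Descend.
Variables (T Y : topologicalType) (Q0 : quotType T) (sigma : T -> T) (N : set T).
Variables (Phi : T -> Y) (y0 : Y).
Local Notation Q := (quotient_topology Q0).
Local Notation cls := (\pi_Q : T -> Q).
Hypotheses (csigma : continuous sigma) (clsS : forall x, cls (sigma x) = cls x).
Hypotheses (oN : open N)
  (Nsat : forall x y, cls x = cls y -> N y -> N x \/ N (sigma x)).
Hypotheses (cPhi : forall x, N x -> {for x, continuous Phi})
  (PhiE : forall x y, N x -> N y -> cls x = cls y -> Phi x = Phi y).

Definition descend (w : Q) : Y := xget y0 (Phi @` (N `&` [set x | cls x = w])).

Lemma descendE x : N x -> descend (cls x) = Phi x.
Proof.
move=> Nx; rewrite /descend; case: xgetP => [y -> [z [Nz /= zx] <-]|].
  exact: PhiE.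
by move=> /(_ (Phi x)) []; exists x.
Qed.

(** By [Nsat], the representatives of the classes in this image form the open set upstairs together
    with its preimage under [sigma]. *)
Lemma saturate_open (O : set Y) : open O ->
  open (cls @` (N `&` Phi @^-1` O)).
Proof.
move=> oO; rewrite /open /= /quotient_open.
have oNO := for_open oN oO cPhi.
rewrite (_ : _ @^-1` _ = (N `&` Phi @^-1` O) `|` sigma @^-1` (N `&` Phi @^-1` O)).
  by apply: openU => //; exact: continuous_open.
apply/seteqP; split=> x /=.
  move=> [y [Ny Oy] yx]; have [Nx|Nx] := Nsat (esym yx) Ny; [left|right]; split => //.
    by rewrite /preimage /= (PhiE Nx Ny).
  by rewrite /preimage /= (PhiE Nx Ny) // clsS.
by move=> [NOx|NOx]; [exists x|exists (sigma x); rewrite ?clsS].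
Qed.

Lemma descend_dom_open : open (cls @` N).
Proof. by have := saturate_open openT; rewrite preimage_setT setIT. Qed.

Lemma descend_for w : (cls @` N) w -> {for w, continuous descend}.
Proof.
move=> [x Nx <-] U; rewrite (descendE Nx) nbhsE => -[B [oB Bx] BU].
apply: (@filterS _ _ _ (cls @` (N `&` Phi @^-1` B))).
  by move=> _ [y [Ny By] <-]; apply: BU; rewrite /= descendE.
by apply: open_nbhs_nbhs; split; [exact: saturate_open|exists x].
Qed.

End Descend.

Section MakePunctured.
Variables (R : realType) (m : nat).
Local Notation C := (R[i]^o).
Local Notation E := 'rV[C]_m.+1.

Lemma punctured_neq0 (z : @punctured R m) : val z != 0.
Proof. by have := valP z; rewrite inE. Qed.

Lemma base_point_in : ins ord0 (0 : 'rV[C]_m) \in @punctured R m.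
Proof. by rewrite inE; exact: ins_neq0. Qed.

Definition base_point : @punctured R m := SigSub base_point_in.

(** Total, with the value [base_point] at 0, so that points of projective space can be given by
    formulas in z. *)
Definition mkP (z : E) : @punctured R m := insubd base_point z.

Lemma val_mkP z : z != 0 -> val (mkP z) = z.
Proof. by move=> z0; rewrite /mkP insubdK // inE. Qed.

Variables (T : topologicalType) (x : T).

Lemma for_val (f : T -> @punctured R m) : {for x, continuous f} ->
  {for x, continuous (fun y => val (f y) : E)}.
Proof. by move=> cf; apply: for_comp => //; exact: initial_continuous. Qed.

Lemma for_set_type (X : topologicalType) (A : set X) (f : T -> A) :
  {for x, continuous (fun y => val (f y) : X)} -> {for x, continuous f}.
Proof.
move=> cf U [_ /= [[W oW <-] Wx WU]].
have : nbhs x (fun y => W (val (f y))) by apply: cf; exact: open_nbhs_nbhs.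
by apply: filterS => y Wy; exact: WU.
Qed.

Lemma for_mkP (f : T -> E) : f x != 0 -> {for x, continuous f} ->
  {for x, continuous (fun y => mkP (f y))}.
Proof.
move=> fx cf; apply: for_set_type => U; rewrite val_mkP // => nU.
have : nbhs x (f @^-1` (U `&` [set z | z != 0])).
  apply: cf; apply: filterI => //; apply: open_nbhs_nbhs; split => //.
  rewrite (_ : [set _ | _] = ~` [set 0]).
    by apply: closed_openC; apply: accessible_closed_set1;
      apply: hausdorff_accessible; exact: norm_hausdorff.
  by apply/seteqP; split=> z /=; [move/eqP|move/eqP].
by apply: filterS => y [Uy y0]; rewrite /= val_mkP.
Qed.

End MakePunctured.

(** * The cylinder and its charts *)

Section Bordism.
Variables (R : realType) (m : nat) (J : 'M[R]_m.+1).
Hypotheses (JT : J^T = - J) (JJ : J *m J = - 1%:M).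
Local Notation C := (R[i]^o).
Local Notation E := 'rV[C]_m.+1.
Local Notation P := (@punctured R m).
Local Notation X := (P * R)%type.
Local Notation tau := (tau J).
Local Notation n := (m.+1 + m)%N.

(** Equality in CP^m x [-1, 1], which [X] presents redundantly; [glue] adds the identification by
    [flip]. *)
Definition same_sheet (x y : X) : Prop :=
  (exists2 c : C, c != 0 & val y.1 = c *: val x.1) /\ clamp y.2 = clamp x.2.

Definition flip (x : X) : X := (mkP (tau (val x.1)), - x.2).

Lemma val_flip x : val (flip x).1 = tau (val x.1).
Proof. by rewrite val_mkP // (tau_eq0 JJ) punctured_neq0. Qed.

Lemma same_refl x : same_sheet x x.
Proof. by split=> //; exists 1; rewrite ?oner_eq0 ?scale1r. Qed.

Lemma same_sym x y : same_sheet x y -> same_sheet y x.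
Proof.
move=> [[c c0 yx] t]; split; last by [].
by exists c^-1; rewrite ?invr_eq0 // yx scalerA mulVf // scale1r.
Qed.

Lemma same_trans y x z : same_sheet x y -> same_sheet y z -> same_sheet x z.
Proof.
move=> [[c c0 yx] t] [[d d0 zy] t']; split; last by rewrite t'.
by exists (d * c); rewrite ?mulf_neq0 // zy yx scalerA.
Qed.

Lemma same_flip x y : same_sheet x y -> same_sheet (flip x) (flip y).
Proof.
move=> [[c c0 yx] t]; split; last by rewrite /= !clampN t.
by exists (conjc c); rewrite ?conjc_eq0 // !val_flip yx tauZ.
Qed.

(** [flip] is an involution only up to the scalar -1, as tau^2 = -1 on vectors. *)
Lemma same_flipK x : same_sheet x (flip (flip x)).
Proof.
split; last by rewrite /= opprK.
by exists (-1); rewrite ?oppr_eq0 ?oner_eq0 // !val_flip (tauK JJ) scaleN1r.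
Qed.

Definition glue (x y : X) : bool := `[< same_sheet x y \/ same_sheet (flip x) y >].

Lemma glue_refl : reflexive glue.
Proof. by move=> x; apply/asboolP; left; exact: same_refl. Qed.

Lemma glue_sym : symmetric glue.
Proof.
suff s x y : glue x y -> glue y x by move=> x y; apply/idP/idP; exact: s.
move=> /asboolP[xy|xy]; apply/asboolP; [left|right]; first exact: same_sym.
apply: same_sym; apply: same_trans (same_flipK x) _; exact: same_flip.
Qed.

Lemma glue_trans : transitive glue.
Proof.
move=> y x z /asboolP[xy|xy] /asboolP[yz|yz]; apply/asboolP.
- by left; exact: same_trans yz.
- by right; apply: same_trans yz; exact: same_flip.
- by right; exact: same_trans yz.
- by left; apply: same_trans (same_flipK x) _; apply: same_trans yz; exact: same_flip.
Qed.

Definition glue_rel := EquivRel glue glue_refl glue_sym glue_trans.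

(* The mapping cylinder of CP^m -> CP^m / tau; the second coordinate is only
   relevant up to [clamp], so it ranges over [-1, 1]. *)
Definition cylinder : topologicalType := quotient_topology {eq_quot glue_rel}.

Definition glue_class (x : X) : cylinder := \pi_cylinder x.
Local Notation cls := glue_class.

Lemma clsP x y : cls x = cls y <-> (same_sheet x y \/ same_sheet (flip x) y).
Proof.
split=> [/eqmodP /asboolP //|xy]; apply/eqmodP; exact/asboolP.
Qed.

Lemma cls_surj w : exists x, cls x = w.
Proof. by exists (generic_quotient.repr w); rewrite /glue_class reprK. Qed.

Lemma cls_same x y : same_sheet x y -> cls x = cls y.
Proof. by move=> xy; apply/clsP; left. Qed.

Lemma cls_flip x : cls (flip x) = cls x.
Proof. by apply/esym/clsP; right; exact: same_refl. Qed.

Lemma cls_continuous : continuous cls.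
Proof. exact: pi_continuous. Qed.

Lemma for_fst (T U V : topologicalType) (x : T) (f : T -> U * V) :
  {for x, continuous f} -> {for x, continuous (fun y => (f y).1)}.
Proof. by move=> cf; apply: for_comp => //; exact: cvg_fst. Qed.

Lemma for_snd (T U V : topologicalType) (x : T) (f : T -> U * V) :
  {for x, continuous f} -> {for x, continuous (fun y => (f y).2)}.
Proof. by move=> cf; apply: for_comp => //; exact: cvg_snd. Qed.

Lemma for_pair (T U V : topologicalType) (x : T) (f : T -> U) (g : T -> V) :
  {for x, continuous f} -> {for x, continuous g} ->
  {for x, continuous (fun y => (f y, g y))}.
Proof. by move=> cf cg; exact: cvg_pair. Qed.

Lemma for_vec (T : topologicalType) (x : T) (f : T -> X) : {for x, continuous f} ->
  {for x, continuous (fun y => val (f y).1 : E)}.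
Proof. by move=> cf; apply: for_val; exact: for_fst. Qed.

Lemma flip_continuous : continuous flip.
Proof.
move=> x; apply: (@for_pair X P R x (fun y => mkP (tau (val y.1))) (fun y => - y.2)).
  apply: for_mkP; first by rewrite (tau_eq0 JJ) punctured_neq0.
  by apply: for_tau; apply: for_vec; exact: for_id.
by apply: (@for_opp R R^o X x); apply: for_snd; exact: for_id.
Qed.

(** * Charts of the cylinder: affine coordinates together with a height *)

Section ChartBuilder.
Variables (p : E) (i : 'I_m.+1) (e b : R) (I : set R) (H : set 'rV[R]_n).
Hypotheses (ee : e * e = 1) (oI : open I).
Hypothesis param_range : forall v, H v -> I (clamp (b + e * dec_t v)) ->
  -1 <= b + e * dec_t v <= 1.
Hypothesis coords_model : forall s, I s -> -1 <= s <= 1 ->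
  forall v, dec_t v = e * (s - b) -> H v.

(** The sign condition admits at most one of the representatives (x, t) and (tau x, - t). The number
    b is the height with coordinate 0, e = 1 or -1 is the direction in which heights are measured,
    and I is the range of heights. *)
Definition sheet_dom : set X :=
  [set x | [/\ 0 < sheet J p (val x.1), val x.1 0 i != 0 & I (clamp x.2)]].

Definition coords (x : X) : 'rV[R]_n := enc (e * (clamp x.2 - b)) (aff i (val x.1)).

Definition param (v : 'rV[R]_n) : X := (mkP (ins i (dec_u v)), b + e * dec_t v).

Lemma val_param v : val (param v).1 = ins i (dec_u v).
Proof. by rewrite val_mkP // ins_neq0. Qed.

Lemma for_param (T : topologicalType) (x : T) (f : T -> 'rV[R]_n) :
  {for x, continuous f} -> {for x, continuous (fun y => param (f y))}.
Proof.
move=> cf; apply: for_pair.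
  by apply: for_mkP; [exact: ins_neq0|apply: for_ins; exact: for_dec_u].
apply: (@for_add R R^o T x); first exact: for_cst.
by apply: (@for_mul R T x); [exact: for_cst|exact: for_dec_t].
Qed.

Lemma for_coords (T : topologicalType) (x : T) (f : T -> X) : val (f x).1 0 i != 0 ->
  {for x, continuous f} -> {for x, continuous (fun y => coords (f y))}.
Proof.
move=> fi cf; apply: for_enc.
  apply: (@for_mul R T x); first exact: for_cst.
  apply: (@for_add R R^o T x); last exact: for_cst.
  by apply: for_clamp; exact: for_snd.
by apply: for_aff => //; exact: for_vec.
Qed.

Lemma sheet_dom_open : open sheet_dom.
Proof.
rewrite openE => x [x1 x2 x3].
have c1 : {for x, continuous (fun y : X => sheet J p (val y.1))}.
  by apply: for_sheet; apply: for_vec; exact: for_id.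
have c2 : {for x, continuous (fun y : X => nsq (val y.1 0 i))}.
  by apply: for_nsq; apply: for_coord; apply: for_vec; exact: for_id.
have c3 : {for x, continuous (fun y : X => clamp y.2)}.
  by apply: for_clamp; apply: for_snd; exact: for_id.
near=> y; split; near: y.
- exact: (c1 _ (open_nbhs_nbhs (conj (@open_gt _ 0) x1))).
- have x2' : 0 < nsq (val x.1 0 i) by rewrite nsq_gt0.
  have h : nbhs x (fun y : X => 0 < nsq (val y.1 0 i)).
    exact: (c2 _ (open_nbhs_nbhs (conj (@open_gt _ 0) x2'))).
  by apply: filterS h => y; rewrite nsq_gt0.
- exact: (c3 _ (open_nbhs_nbhs (conj oI x3))).
Unshelve. all: by end_near. Qed.

Lemma same_sheet_dom x y : same_sheet x y -> sheet_dom x -> sheet_dom y.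
Proof.
move=> [[c c0 yx] t] [x1 x2 x3]; split; last by rewrite t.
  by rewrite yx sheetZ mulr_gt0 // nsq_gt0.
by rewrite yx mxE mulf_neq0.
Qed.

Lemma sheet_dom_sat x y : cls x = cls y -> sheet_dom y -> sheet_dom x \/ sheet_dom (flip x).
Proof.
by move=> /clsP[/same_sym xy|/same_sym xy] ys; [left|right]; exact: same_sheet_dom ys.
Qed.

(** Two points of the domain in one class cannot differ by [flip], which changes the sign of
    [sheet]; so they differ by a scalar, to which affine coordinates are insensitive. *)
Lemma coordsE x y : sheet_dom x -> sheet_dom y -> cls x = cls y -> coords x = coords y.
Proof.
move=> [x1 _ _] [y1 _ _] /clsP[] [[c c0 yx] t]; rewrite /coords.
  by rewrite t yx affZ.
move: y1; rewrite yx sheetZ val_flip (sheet_tau JJ) mulrN oppr_gt0.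
by rewrite ltNge mulr_ge0 ?nsq_ge0 // ltW.
Qed.

Lemma coordsK (x : X) : val x.1 0 i != 0 -> same_sheet (param (coords x)) x.
Proof.
move=> x2; split.
  exists (val x.1 0 i) => //.
  by rewrite val_param /coords enc_u ins_aff // scalerA divff // scale1r.
by rewrite /= /coords enc_t mulrA ee mul1r addrC subrK clampK.
Qed.

Lemma paramK v : -1 <= b + e * dec_t v <= 1 -> coords (param v) = v.
Proof.
move=> bt; rewrite /coords val_param aff_ins /= clamp_id // addrC addKr mulrA ee.
by rewrite mul1r encK.
Qed.

Let N := sheet_dom.
Let phi : cylinder -> 'rV[R]_n := descend N coords 0.

Let phiE x : N x -> phi (cls x) = coords x.
Proof. by apply: descendE; exact: coordsE. Qed.

Lemma chart_for x : N x -> {for x, continuous coords}.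
Proof. by move=> [_ xi _]; apply: for_coords; last exact: for_id. Qed.

(** [coords_model] gives one inclusion. For the other, [param_range] ensures that [clamp] does not
    move the height of [param v], whose coordinates are therefore v. *)
Lemma param_image : phi @` (cls @` N) = (param @^-1` N) `&` H.
Proof.
apply/seteqP; split=> [_ [_ [x Nx <-] <-]|v [Nv Hv]].
  rewrite phiE //; split.
    by apply: (same_sheet_dom _ Nx); apply: same_sym; apply: coordsK; case: Nx.
  case: Nx => _ _ Ix; apply: (coords_model Ix); first by rewrite clamp_ge clamp_le.
  by rewrite enc_t.
have Nb : -1 <= b + e * dec_t v <= 1.
  by case: Nv => _ _ /= Iv; exact: param_range.
exists (cls (param v)); first by exists (param v).
by rewrite phiE // paramK.
Qed.

Lemma sheet_chart_open : open (cls @` N).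
Proof.
apply: (descend_dom_open flip_continuous cls_flip sheet_dom_open sheet_dom_sat).
  exact: chart_for.
exact: coordsE.
Qed.

Lemma sheet_chart_for w : (cls @` N) w -> {for w, continuous phi}.
Proof.
exact: (@descend_for X 'rV[R]_n _ flip N coords 0 flip_continuous cls_flip
  sheet_dom_open sheet_dom_sat chart_for coordsE).
Qed.

Lemma param_continuous : continuous param.
Proof. by move=> v; apply: for_param; exact: for_id. Qed.

Lemma sheet_chart_image :
  exists2 V : set 'rV[R]_n, open V & phi @` (cls @` N) = V `&` H.
Proof.
exists (param @^-1` N); last exact: param_image.
by apply: continuous_open sheet_dom_open; exact: param_continuous.
Qed.

Lemma sheet_chart_map_continuous : {within cls @` N, continuous phi}.
Proof.
by apply: continuous_in_subspaceT => w; rewrite inE; exact: sheet_chart_for.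
Qed.

Lemma sheet_chart_inv_continuous :
  {within phi @` (cls @` N), continuous (cls \o param)}.
Proof.
apply: continuous_subspaceT => v; apply: continuous_comp.
  exact: param_continuous.
exact: cls_continuous.
Qed.

Lemma sheet_chartK w : (cls @` N) w -> cls (param (phi w)) = w.
Proof. by move=> [x Nx <-]; rewrite phiE //; apply: cls_same; apply: coordsK; case: Nx. Qed.

Definition sheet_chart : chart H cylinder :=
  Chart sheet_chart_open sheet_chart_image sheet_chart_map_continuous
    sheet_chart_inv_continuous sheet_chartK.

Lemma sheet_chart_mapE x : N x -> chart_map sheet_chart (cls x) = coords x.
Proof. exact: phiE. Qed.

End ChartBuilder.

Lemma has_rep w : exists x p i, [/\ cls x = w, 0 < sheet J p (val x.1) & val x.1 0 i != 0].
Proof.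
have [x <-] := cls_surj w; have x0 := punctured_neq0 x.1.
have /rV0Pn[i xi] := x0.
by exists x, (val x.1), i; split=> //; exact: sheet_diag.
Qed.

Lemma half_spaceP (v : 'rV[R]_n) : half_space R n v <-> 0 <= dec_t v.
Proof.
split=> [|v0 i i0]; first by apply.
by rewrite (_ : i = lshift m ord0) //; exact: val_inj.
Qed.

Lemma wallP (v : 'rV[R]_n) : wall R n v <-> dec_t v = 0.
Proof.
split=> [[i i0 vi]|v0]; last by exists (lshift m ord0).
by rewrite -vi; congr (v 0 _); exact: val_inj.
Qed.

Section Charts.
Variables (p : E) (i : 'I_m.+1).

Lemma top_param_range v : half_space R n v -> -1 < clamp (1 + -1 * dec_t v) ->
  -1 <= 1 + -1 * dec_t v <= 1.
Proof.
move=> /half_spaceP v0; rewrite /clamp mulN1r lt_max ltxx /= lt_min => /andP[_ v1].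
by rewrite ltW //= gerBl.
Qed.

Lemma top_coords_model s : -1 < s -> -1 <= s <= 1 -> forall v, dec_t v = -1 * (s - 1) ->
  half_space R n v.
Proof. by move=> s0 /andP[_ s1] v vs; apply/half_spaceP; rewrite vs; lra. Qed.

Lemma bot_param_range v : half_space R n v -> clamp (-1 + 1 * dec_t v) < 1 ->
  -1 <= -1 + 1 * dec_t v <= 1.
Proof.
move=> /half_spaceP v0; rewrite /clamp mul1r gt_max gt_min ltxx /= => /andP[_ v1].
by rewrite lerDl v0 ltW.
Qed.

Lemma bot_coords_model s : s < 1 -> -1 <= s <= 1 -> forall v, dec_t v = 1 * (s - -1) ->
  half_space R n v.
Proof. by move=> s0 /andP[s1 _] v vs; apply/half_spaceP; rewrite vs; lra. Qed.

Lemma mid_param_range v : euclidean R n v ->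
  ([set s : R | -1 < s] `&` [set s | s < 1]) (clamp (0 + 1 * dec_t v)) ->
  -1 <= 0 + 1 * dec_t v <= 1.
Proof.
move=> _; rewrite /= /clamp add0r mul1r lt_max gt_max gt_min lt_min !ltxx /=.
by move=> [/andP[_ v0] /andP[_ v1]]; rewrite (ltW v0) (ltW v1).
Qed.

Lemma mid_coords_model s : ([set s : R | -1 < s] `&` [set s | s < 1]) s ->
  -1 <= s <= 1 -> forall v, dec_t v = 1 * (s - 0) ->
  euclidean R n v.
Proof. by []. Qed.

(** The height coordinate is 1 - t here, for t > -1; it is t + 1 in [bot_chart], for t < 1, and t
    itself in [mid_chart]. *)
Definition top_chart : chart (half_space R n) cylinder :=
  sheet_chart p i (etrans (mulrNN 1 1) (mulr1 1)) (@open_gt _ (-1)) top_param_range top_coords_model.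

Definition bot_chart : chart (half_space R n) cylinder :=
  sheet_chart p i (mulr1 1) (@open_lt _ 1) bot_param_range bot_coords_model.

Definition mid_chart : chart (euclidean R n) cylinder :=
  sheet_chart p i (mulr1 1) (openI (@open_gt _ (-1)) (@open_lt _ 1)) mid_param_range mid_coords_model.

End Charts.

Lemma cylinder_half_chart w :
  exists c : chart (half_space R n) cylinder, chart_dom c w.
Proof.
have [x [p [i [<- xp xi]]]] := has_rep w.
have [x1|x1] := ltP (-1) (clamp x.2).
  by exists (top_chart p i), x.
by exists (bot_chart p i), x => //; split=> //=; apply: le_lt_trans x1 _; lra.
Qed.

(** The ends t = 1 and t = -1, glued to each other, are put on the wall by [top_chart] and
    [bot_chart]. Any other point lies in a [mid_chart], and [interior_not_wall] applies. *)
Lemma cylinder_boundary :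
  boundary R n cylinder = [set w | exists2 x, clamp x.2 = 1 & cls x = w].
Proof.
apply/seteqP; split=> w; last first.
  move=> [y y1 <-]; have [x [p [i [yx xp xi]]]] := has_rep (cls y).
  have [x1|x1] : clamp x.2 = 1 \/ clamp x.2 = -1.
    move/clsP: yx => [] [_]; first by move=> <-; left.
    by rewrite y1 /= clampN => e; right; rewrite e opprK.
    rewrite -yx; exists (top_chart p i).
      by exists x => //; split=> //=; rewrite x1; lra.
    rewrite sheet_chart_mapE; last by split=> //=; rewrite x1; lra.
    by apply/wallP; rewrite enc_t x1 subrr mulr0.
  rewrite -yx; exists (bot_chart p i).
    by exists x => //; split=> //=; rewrite x1; lra.
  rewrite sheet_chart_mapE; last by split=> //=; rewrite x1; lra.
  by apply/wallP; rewrite enc_t x1 subrr mulr0.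
move=> [c cw wc]; have [x [p [i [xw xp xi]]]] := has_rep w.
have [x1|x1] := eqVneq (clamp x.2) 1; first by exists x.
have [x2|x2] := eqVneq (clamp x.2) (-1).
  by exists (flip x); rewrite ?cls_flip //= clampN x2 opprK.
have xm : chart_dom (mid_chart p i) w.
  exists x => //; split=> //=; split; rewrite lt_neqAle ?clamp_ge ?clamp_le ?x1 //.
  by rewrite eq_sym x2.
by have := interior_not_wall xm cw wc.
Qed.

End Bordism.

(** * Compactness and separation axioms *)

Section SecondCountable.
Variable R : realType.

Definition rational_ball n (qk : 'rV[rat]_n * nat) : set 'rV[R]_n :=
  ball (map_mx ratr qk.1 : 'rV[R]_n) (qk.2.+1%:R^-1).

Lemma rational_ball_basis n (v : 'rV[R]_n) U : nbhs v U ->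
  exists2 qk, rational_ball qk v & rational_ball qk `<=` U.
Proof.
move=> /nbhs_ballP[e /= e0 eU].
have e2 : 0 < e / 2 by rewrite divr_gt0.
have [k ke] : exists k, k.+1%:R^-1 < e / 2.
  by have [k _ kP] := near_infty_natSinv_lt (PosNum e2); exists k; exact: kP k (leqnn k).
have k0 : 0 < k.+1%:R^-1 :> R by rewrite invr_gt0.
have qi i : exists q : rat, `|v 0 i - ratr q| < k.+1%:R^-1.
  move: (k.+1%:R^-1) k0 => d d0; have vd : v 0 i - d < v 0 i + d by lra.
  have [q] := rat_in_itvoo vd; rewrite in_itv /= => /andP[q1 q2].
  by exists q; rewrite ltr_norml; apply/andP; split; lra.
have [q qP] := choice qi.
pose qk : 'rV[rat]_n * nat := (\row_i q i, k).
have near1 : rational_ball qk v.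
  by split=> // a i; rewrite ord1 !mxE /ball /= distrC; exact: qP.
exists qk => // w qw; apply: eU; apply: (@le_ball _ _ _ (k.+1%:R^-1 + k.+1%:R^-1)).
  by rewrite [e]splitr ltW // ltrD.
by apply: ball_triangle qw; exact: ball_sym.
Qed.

(** Finitely many chart domains cover M, and the preimages of rational balls under these charts form
    a countable base. *)
Lemma compact_charts_second_countable n (H : set 'rV[R]_n) (M : topologicalType) :
  compact [set: M] -> (forall x : M, exists c : chart H M, chart_dom c x) ->
  @second_countable M.
Proof.
move=> Mco /choice[c cP].
have [D Dfin Dcov] : exists2 D : set M, finite_set D &
    forall x, exists2 y, D y & chart_dom (c y) x.
  have [[x0 _]|M0] := pselect (exists x : M, True); last first.
    by exists set0 => // x; case: M0; exists x.
  (* [compact_cover] is about pointed spaces, hence the base point x0 and the separate case of an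
     empty M. *)
  pose Mp : ptopologicalType := HB.pack (Topological.sort M) (isPointed.Build (Topological.sort M) x0).
  have : @compact Mp [set: Mp] by exact: Mco.
  rewrite compact_cover => /(_ M setT (fun x => chart_dom (c x))).
  case; [by move=> x _; exact: chart_dom_open|by move=> x _; exists x|].
  move=> D _ Dcov; exists [set` D]; first exact: finite_fset.
  by move=> x; exact: (Dcov x I).
pose piece (x : M) qk := chart_dom (c x) `&` chart_map (c x) @^-1` (rational_ball qk).
exists (\bigcup_(x in D) (range (piece x))); [|split].
- apply: bigcup_countable; first exact: finite_set_countable.
  move=> x _; apply: (@sub_countable _ _ _ [set: 'rV[rat]_n * nat]); last exact: countableP.
  exact: card_image_le.
- move=> _ [x _ [qk _ <-]]; apply: for_open; first exact: chart_dom_open.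
    exact: ball_open.
  exact: chart_map_for.
move=> x U nU; have [y yD yx] := Dcov x.
have [V oV cV] := chart_image_open (c y).
pose v := chart_map (c y) x.
have cv : (chart_map (c y) @` chart_dom (c y)) v by exists x.
have Vv : V v by move: cv; rewrite cV => -[].
have := @chart_inv_continuous _ _ _ _ (c y); rewrite subspace_continuousP => /(_ v cv).
rewrite /from_subspace chart_mapK // => /(_ _ nU) near1.
have {}near1 : nbhs v (fun w => (chart_map (c y) @` chart_dom (c y)) w ->
  U (chart_inv (c y) w)) by exact: near1.
have [qk qv qU] := rational_ball_basis (filterI (open_nbhs_nbhs (conj oV Vv)) near1).
exists (piece y qk).
  by split; [exists y => //; exists qk|split].
move=> z [yz qz]; have [_ /(_ (imageP _ yz))] := qU _ qz.
by rewrite chart_mapK.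
Qed.

End SecondCountable.

Lemma separated_hausdorff (R : realType) (M : topologicalType) :
  (forall x y : M, x <> y -> exists2 f : M -> R, continuous f & f x <> f y) ->
  hausdorff_space M.
Proof.
move=> sep x y xy; apply: contrapT => /sep[f cf]; apply.
apply: (@norm_hausdorff _ R^o) => A B nA nB.
have [z [Az Bz]] := xy _ _ (cf x _ nA) (cf y _ nB).
by exists (f z).
Qed.

(** * The cylinder is a compact manifold with boundary *)

Section Cylinder.
Variables (R : realType) (m : nat) (J : 'M[R]_m.+1).
Hypotheses (JT : J^T = - J) (JJ : J *m J = - 1%:M).
Local Notation C := (R[i]^o).
Local Notation E := 'rV[C]_m.+1.
Local Notation P := (@punctured R m).
Local Notation X := (P * R)%type.
Local Notation tau := (tau J).
Local Notation n := (m.+1 + m)%N.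
Local Notation W := (cylinder JJ).
Local Notation cls := (glue_class JJ : X -> W).

(** Twice |z ^ w|^2 / |w|^2. For nonzero vectors it vanishes exactly if they are proportional, and
    the division makes it a function of the line of w. *)
Definition wedge2 (z w : E) : R :=
  (\sum_a \sum_b nsq (w 0 a * z 0 b - w 0 b * z 0 a)) / \sum_a nsq (w 0 a).

Lemma sum_nsq_neq0 (w : E) : w != 0 -> \sum_a nsq (w 0 a) != 0.
Proof.
move=> w0; rewrite psumr_neq0 => [|a _]; last exact: nsq_ge0.
have /rV0Pn[a wa] := w0.
by apply/hasP; exists a; rewrite ?mem_index_enum // nsq_gt0.
Qed.

Lemma wedge2_ge0 z w : 0 <= wedge2 z w.
Proof.
by rewrite divr_ge0 ?sumr_ge0 // => a _; rewrite ?sumr_ge0 ?nsq_ge0 // => b _; exact: nsq_ge0.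
Qed.

Lemma wedge2Z z c w : c != 0 -> wedge2 z (c *: w) = wedge2 z w.
Proof.
move=> c0; rewrite /wedge2.
rewrite (eq_bigr (fun a => nsq c * \sum_b nsq (w 0 a * z 0 b - w 0 b * z 0 a))); last first.
  move=> a _; rewrite mulr_sumr; apply: eq_bigr => b _.
  by rewrite !mxE -!mulrA -mulrBr nsqM.
rewrite [X in _ / X](eq_bigr (fun a => nsq c * nsq (w 0 a))); last first.
  by move=> a _; rewrite !mxE nsqM.
by rewrite -!mulr_sumr -mulf_div divff ?mul1r // nsq_eq0.
Qed.

Lemma wedge2_refl z : wedge2 z z = 0.
Proof.
rewrite /wedge2 big1 ?mul0r // => a _; rewrite big1 // => b _.
by rewrite mulrC subrr /nsq /= expr0n addr0.
Qed.

Lemma wedge2_eq0 z w : z != 0 -> w != 0 -> wedge2 z w = 0 ->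
  exists2 c : C, c != 0 & w = c *: z.
Proof.
move=> z0 w0 /eqP; rewrite mulf_eq0 invr_eq0 (negbTE (sum_nsq_neq0 w0)) orbF.
rewrite psumr_eq0 => [/allP wz|a _]; last by rewrite sumr_ge0 // => b _; exact: nsq_ge0.
have {}wz a b : w 0 a * z 0 b = w 0 b * z 0 a.
  have := wz a (mem_index_enum a); rewrite /= psumr_eq0 => [/allP|? _]; last exact: nsq_ge0.
  by move=> /(_ b (mem_index_enum b)); rewrite /= nsq_eq0 subr_eq0 => /eqP.
have /rV0Pn[b zb] := z0.
have wE : w = (w 0 b / z 0 b) *: z.
  by apply/rowP => a; rewrite mxE mulrAC -wz mulfK.
exists (w 0 b / z 0 b) => //; apply: contra_neq w0 => c0.
by rewrite wE c0 scale0r.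
Qed.

(** The factors vanish exactly if x is identified by [same_sheet] with y, respectively with
    [flip y]. Flipping y exchanges them, so the product descends to a continuous function on W whose
    only zero is the class of x. *)
Definition separator (x y : X) : R :=
  (wedge2 (val x.1) (val y.1) + `|clamp y.2 - clamp x.2|) *
  (wedge2 (val x.1) (tau (val y.1)) + `|clamp y.2 + clamp x.2|).

Lemma separator_same x y y' : same_sheet y y' -> separator x y = separator x y'.
Proof.
by move=> [[c c0 yE] t]; rewrite /separator yE tauZ !wedge2Z ?conjc_eq0 // t.
Qed.

Lemma separator_flip x y : separator x (flip J y) = separator x y.
Proof.
rewrite /separator (val_flip JJ) (tauK JJ) /= clampN -(scaleN1r (val y.1)).
rewrite wedge2Z ?oppr_eq0 ?oner_eq0 // mulrC; congr ((_ + _) * (_ + _)).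
  by rewrite -normrN opprD opprK.
by rewrite -normrN opprD !opprK.
Qed.

Lemma separator_eq0 x y : separator x y = 0 -> cls x = cls y.
Proof.
have x0 := punctured_neq0 x.1; have y0 := punctured_neq0 y.1.
move/eqP; rewrite mulf_eq0 => /orP[]; rewrite paddr_eq0 ?wedge2_ge0 //
  normr_eq0 => /andP[/eqP w0 t0].
  by apply: cls_same; split; [exact: wedge2_eq0|apply/eqP; rewrite -subr_eq0].
rewrite -(cls_flip JJ y); apply: cls_same; split.
  by rewrite val_flip //; apply: wedge2_eq0; rewrite ?(tau_eq0 JJ).
by apply/eqP; rewrite /= clampN eqr_oppLR -subr_eq0 opprK.
Qed.

Lemma separator_refl x : separator x x = 0.
Proof. by rewrite /separator wedge2_refl subrr normr0 addr0 mul0r. Qed.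

Lemma for_wedge2 (T : topologicalType) (t : T) z (f : T -> E) : f t != 0 ->
  {for t, continuous f} -> {for t, continuous (fun y => wedge2 z (f y))}.
Proof.
move=> ft cf; have cc a : {for t, continuous (fun y => f y 0 a)} by exact: for_coord.
apply: (@for_mul R T t).
  apply: (@for_sum T t R) => a; apply: (@for_sum T t R) => b; apply: for_nsq.
  apply: (@for_add R[i] R[i]^o T t); last apply: (@for_opp R[i] R[i]^o T t).
    by apply: (@for_mul R[i] T t); [|exact: for_cst].
  by apply: (@for_mul R[i] T t); [|exact: for_cst].
apply: (@for_inv R T t); first exact: sum_nsq_neq0.
by apply: (@for_sum T t R) => a; exact: for_nsq.
Qed.

Lemma separator_continuous x : continuous (separator x).
Proof.
move=> y; have c1 : {for y, continuous (fun y : X => val y.1 : E)}.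
  by apply: for_vec; exact: for_id.
have c2 : {for y, continuous (fun y : X => clamp y.2)}.
  by apply: for_clamp; apply: for_snd; exact: for_id.
apply: (@for_mul R X y); apply: (@for_add R R^o X y).
- by apply: for_wedge2 => //; exact: punctured_neq0.
- apply: (@for_norm R R^o X y); apply: (@for_add R R^o X y) => //; exact: for_cst.
- by apply: for_wedge2; [rewrite (tau_eq0 JJ) punctured_neq0|exact: for_tau].
- apply: (@for_norm R R^o X y); apply: (@for_add R R^o X y) => //; exact: for_cst.
Qed.

Lemma cylinder_hausdorff : hausdorff_space W.
Proof.
apply: (@separated_hausdorff R) => v w; have [x <-] := cls_surj v.
have [y <-] := cls_surj w => xy.
have sE z z' : cls z = cls z' -> separator x z = separator x z'.
  by move=> /clsP[|] /(separator_same x) <- //; rewrite separator_flip.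
have rE z : separator x (generic_quotient.repr (cls z)) = separator x z.
  by apply: sE; rewrite {1}/glue_class reprK.
exists (separator x \o generic_quotient.repr); last first.
  by rewrite /= !rE separator_refl => /esym/separator_eq0.
apply: repr_comp_continuous; first exact: separator_continuous.
by move=> z z' /eqP zz'; apply/eqP/sE.
Qed.

Lemma unit_cube_compact N : compact [set v : 'rV[R]_N | forall i, v ord0 i \in `[-1, 1]].
Proof.
apply: (@rV_compact _ _ (fun=> `[(-1 : R), 1]%classic)) => _; exact: segment_compact.
Qed.

Lemma unit_disc (c : C) : nsq c <= 1 ->
  (complex.Re c \in `[-1, 1]) /\ (complex.Im c \in `[-1, 1]).
Proof.
case: c => a b; rewrite /nsq /= => ab; rewrite !in_itv /=.
have a0 := sqr_ge0 a; have b0 := sqr_ge0 b.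
by split; apply/andP; split; nra.
Qed.

(** Division by a coordinate of largest modulus brings the affine coordinates into the unit disc, so
    W is a union of m + 1 continuous images of a cube. *)
Lemma cylinder_compact : compact [set: W].
Proof.
pose cube := [set v : 'rV[R]_n | forall i, v ord0 i \in `[-1, 1]].
pose F i := (fun v => cls (param i 1 0 v)) @` cube.
suff -> : [set: W] = \big[setU/set0]_(i < m.+1) F i.
  apply: bigsetU_compact => i _; apply: continuous_compact; last exact: unit_cube_compact.
  apply: continuous_subspaceT => v; apply: continuous_comp; last exact: cls_continuous.
  exact: param_continuous.
apply/seteqP; split=> // w _; have [x <-] := cls_surj w.
have x0 := punctured_neq0 x.1.
pose i := [arg max_(i > ord0 : 'I_m.+1) nsq (val x.1 0 i)]%O.
have imax l : nsq (val x.1 0 l) <= nsq (val x.1 0 i).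
  by rewrite /i; case: arg_maxP => // k _ kP; exact: kP.
have xi : val x.1 0 i != 0.
  apply: contra_neq x0 => xi0; apply/rowP => l; rewrite mxE; apply/eqP.
  by rewrite -nsq_eq0 eq_le nsq_ge0 andbT (le_trans (imax l)) // xi0 /nsq /= expr0n addr0.
suff Fi : F i (cls x) by rewrite (bigD1 i) //=; left.
exists (coords i 1 0 x); last by apply: cls_same; apply: coordsK; rewrite ?mulr1.
have affle l : nsq (aff i (val x.1) 0 l) <= 1.
  rewrite mxE -[leLHS]mulr1 -[X in _ * X](@mulfV _ (nsq (val x.1 0 i))) ?nsq_eq0 //.
  by rewrite mulrA -nsqM divfK // ler_pdivrMr ?mul1r ?nsq_gt0.
move=> k; rewrite /coords /enc; case: (split_ordP k) => a ->.
  rewrite row_mxEl mxE; case: (unliftP ord0 a) => [l|] _.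
    exact: (unit_disc (affle l)).2.
  by rewrite mul1r subr0 in_itv /= clamp_ge clamp_le.
by rewrite row_mxEr mxE; exact: (unit_disc (affle a)).1.
Qed.

Lemma cylinder_manifold : manifold_with_boundary R n W.
Proof.
split; first exact: cylinder_hausdorff; last exact: cylinder_half_chart.
exact: compact_charts_second_countable cylinder_compact (cylinder_half_chart JT (JJ := JJ)).
Qed.

End Cylinder.

(** * The boundary *)

Section BoundaryHomeo.
Variables (R : realType) (m : nat) (J : 'M[R]_m.+1).
Hypotheses (JT : J^T = - J) (JJ : J *m J = - 1%:M).
Local Notation C := (R[i]^o).
Local Notation E := 'rV[C]_m.+1.
Local Notation P := (@punctured R m).
Local Notation X := (P * R)%type.
Local Notation n := (m.+1 + m)%N.
Local Notation W := (cylinder JJ).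
Local Notation cls := (glue_class JJ : X -> W).
Local Notation CP := (complex_projective R m).

Definition line (z : P) : CP := \pi_CP z.

Lemma lineP z z' : line z = line z' <-> exists2 c : C, c != 0 & val z' = c *: val z.
Proof.
split=> [/eqmodP /asboolP //|zz]; apply/eqmodP; exact/asboolP.
Qed.

Lemma lineK q : line (generic_quotient.repr q) = q.
Proof. by rewrite /line reprK. Qed.

(** Over this open set the class determines the line, since [flip] leads to negative heights. The
    projection to CP^m therefore descends to a neighbourhood of the boundary. *)
Definition upper : set X := [set x | 0 < x.2].

Lemma clamp_gt0 (t : R) : (0 < clamp t) = (0 < t).
Proof. by rewrite /clamp lt_max lt_min ltr01 andTb oppr_gt0 ltr10. Qed.

Lemma upper_open : open upper.
Proof.
rewrite openE => x x0; have c : {for x, continuous (fun y : X => y.2)}.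
  by apply: for_snd; exact: for_id.
exact: (c _ (open_nbhs_nbhs (conj (@open_gt _ 0) x0))).
Qed.

Lemma upper_sat x y : cls x = cls y -> upper y -> upper x \/ upper (flip J x).
Proof.
rewrite /upper /= -clamp_gt0 => /clsP[] [_ ->]; first by rewrite clamp_gt0; left.
by rewrite clamp_gt0; right.
Qed.

Lemma upper_line x y : upper x -> upper y -> cls x = cls y -> line x.1 = line y.1.
Proof.
rewrite /upper /= => x0 y0 /clsP[] [xy t]; first exact/lineP.
by move: y0; rewrite -clamp_gt0 t /= clamp_gt0 oppr_gt0 ltNge ltW.
Qed.

Lemma upper_line_for x : upper x -> {for x, continuous (fun y : X => line y.1)}.
Proof.
move=> _; apply: for_comp; first by apply: for_fst; exact: for_id.
exact: pi_continuous.
Qed.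

Let B := boundary R n W.
Let down : W -> CP := descend upper (fun y : X => line y.1) (line (base_point R m)).

Lemma downE x : upper x -> down (cls x) = line x.1.
Proof. by apply: descendE; exact: upper_line. Qed.

Lemma top_in_boundary z : cls (z, 1) \in B.
Proof.
by apply/mem_set; rewrite /B (cylinder_boundary JT JJ); exists (z, 1) => //=; rewrite clamp_id; lra.
Qed.

Lemma boundary_homeomorphic : homeomorphic B CP.
Proof.
exists (fun w : B => down (val w)).
exists (fun q => exist _ (cls (generic_quotient.repr q, 1)) (top_in_boundary _) : B).
have Bup (w : B) : exists2 x, upper x & clamp x.2 = 1 /\ cls x = val w.
  have := set_valP w; rewrite {1}/B (cylinder_boundary JT JJ) => -[x x1 xw].
  by exists x => //; rewrite /upper /= -clamp_gt0 x1.
have u1 z : upper (z, 1) by rewrite /upper /=.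
split.
- move=> w; apply: (@for_comp B w W CP val down).
    exact: initial_continuous.
  apply: (@descend_for X CP _ _ upper _ _ (@flip_continuous _ _ _ JJ) (cls_flip JJ)
    upper_open upper_sat upper_line_for upper_line).
  by have [x x0 [_ xw]] := Bup w; exists x.
- move=> q; apply: for_set_type => /=.
  apply: (@repr_comp_continuous _ _ _ (fun z : P => cls (z, 1))).
    move=> z; apply: (@for_comp P z X W (fun y => (y, 1)) cls); last exact: cls_continuous.
    by apply: for_pair; [exact: for_id|exact: for_cst].
  move=> z z' /eqP zz'; apply/eqP/cls_same; split=> //; exact/lineP.
- move=> w; apply: val_inj => /=; have [x x0 [x1 <-]] := Bup w.
  rewrite downE //; apply: cls_same; split; last by rewrite /= x1 clamp_id //; lra.
  by apply/lineP; rewrite lineK.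
- by move=> q /=; rewrite downE // lineK.
Qed.

End BoundaryHomeo.

(** * Orientation *)

Lemma within_eq (T U : topologicalType) (A : set T) (f g : T -> U) :
  (forall x, A x -> f x = g x) -> {within A, continuous f} -> {within A, continuous g}.
Proof.
move=> fg cf; apply/subspace_continuousP => x Ax; rewrite /from_subspace -fg //.
move/subspace_continuousP : cf => /(_ x Ax) cf; apply: cvg_trans cf.
by apply: fmap_within_eq => y /set_mem Ay; symmetry; exact: fg.
Qed.

(** * Construction, composition and concatenation of homotopies *)

Section Homotopy.
Variables (R : realType) (X Y : topologicalType).

Lemma homotopic_formula (A : set X) (B : set Y) (f g : X -> Y) (h : R * X -> Y) :
  (forall (s : R) (x : X), 0 <= s <= 1 -> A x ->
    {for (s, x), continuous h} /\ B (h (s, x))) ->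
  (forall x, A x -> h (0, x) = f x) -> (forall x, A x -> h (1, x) = g x) ->
  homotopic R A B f g.
Proof.
move=> hP h0 h1; exists h; split=> //.
- apply: continuous_in_subspaceT => -[s x] /set_mem [/= s01 Ax].
  by move: s01; rewrite in_itv /= => s01; exact: (hP s x s01 Ax).1.
- by move=> [s x] [/= s01 Ax]; apply: (hP s x _ Ax).2; move: s01; rewrite in_itv.
Qed.

Lemma homotopic_ext (A : set X) (B : set Y) (f f' g : X -> Y) :
  (forall x, A x -> f x = f' x) -> homotopic R A B f g -> homotopic R A B f' g.
Proof. by move=> ff' [h [ch hB h0 h1]]; exists h; split=> // x Ax; rewrite h0 // ff'. Qed.

Lemma homotopic_precomp (Z : topologicalType) (A : set X) (D : set Z) (B : set Y)
    (f g : X -> Y) (k : Z -> X) :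
  (forall z, D z -> A (k z)) -> continuous k ->
  homotopic R A B f g -> homotopic R D B (f \o k) (g \o k).
Proof.
move=> DA ck [h [ch hB h0 h1]].
exists (fun p => h (p.1, k p.2)); split.
- apply: (@within_comp (R * Z)%type (R * X)%type Y _ (`[0, 1]%classic `*` A)
    (fun p => (p.1, k p.2)) h) => //.
    by move=> [s z] [/= s01 Dz]; split=> //; exact: DA.
  apply: continuous_subspaceT => -[s z]; apply: for_pair; first exact: cvg_fst.
  by apply: (@for_comp _ (s, z) _ _ snd k); [exact: cvg_snd|exact: ck].
- by move=> [s z] [/= s01 Dz]; apply: hB; split=> //; exact: DA.
- by move=> z Dz; rewrite h0 //; exact: DA.
- by move=> z Dz; rewrite h1 //; exact: DA.
Qed.

(** Both homotopies run at double speed. As A is closed, the two halves of the cylinder over A are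
    closed and the pasting lemma applies. *)
Lemma homotopic_trans (A : set X) (B : set Y) (f g k : X -> Y) : closed A ->
  homotopic R A B f g -> homotopic R A B g k -> homotopic R A B f k.
Proof.
move=> cA [h [ch hB h0 h1]] [h' [ch' h'B h'0 h'1]].
pose F (p : R * X) := if p.1 <= 1 / 2 then h (2 * p.1, p.2) else h' (2 * p.1 - 1, p.2).
have clo a b : closed (`[a, b]%classic `*` A : set (R * X)).
  apply: (@closedI _ (fst @^-1` `[a, b]%classic) (snd @^-1` A)).
    by apply: closed_comp; [move=> p _; exact: cvg_fst|exact: interval_closed].
  by apply: closed_comp => // p _; exact: cvg_snd.
have pieceE : `[(0 : R), 1]%classic `*` A =
    (`[(0 : R), 1 / 2]%classic `*` A) `|` (`[(1 / 2 : R), 1]%classic `*` A).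
  apply/seteqP; split=> [[s x] [/= s01 Ax]|[s x] [] [/= s01 Ax]]; last 2 first.
  - by split=> //=; move: s01; rewrite !in_itv /= => /andP[? ?]; apply/andP; split; lra.
  - by split=> //=; move: s01; rewrite !in_itv /= => /andP[? ?]; apply/andP; split; lra.
  move: s01; rewrite !in_itv /= => /andP[s0 s1].
  by have [s2|s2] := leP s (1 / 2); [left|right]; split=> //=; rewrite ?in_itv /=;
    apply/andP; split; lra.
exists F; split.
- rewrite pieceE; apply: withinU_continuous; [exact: clo|exact: clo| |].
  + apply: (@within_eq (R * X)%type Y _ (fun p => h (2 * p.1, p.2)) F).
      move=> [s x] [/= s01 Ax]; rewrite /F /=.
      by move: s01; rewrite in_itv /= => /andP[_ ->].
    apply: (@within_comp (R * X)%type (R * X)%type Y _ (`[0, 1]%classic `*` A)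
      (fun p => (2 * p.1, p.2)) h) => //.
      move=> [s x] [/= s01 Ax]; split=> //=.
      by move: s01; rewrite !in_itv /= => /andP[? ?]; apply/andP; split; lra.
    apply: continuous_subspaceT => -[s z].
    apply: (@for_pair (R * X)%type R X (s, z) (fun p => 2 * p.1) snd); last exact: cvg_snd.
    by apply: (@for_mul R (R * X)%type (s, z)); [exact: for_cst|exact: cvg_fst].
  + apply: (@within_eq (R * X)%type Y _ (fun p => h' (2 * p.1 - 1, p.2)) F).
      move=> [s x] [/= s01 Ax]; rewrite /F /=.
      move: s01; rewrite in_itv /= => /andP[s2 s1]; case: ifP => // s3.
      have -> : s = 1 / 2 by apply/eqP; rewrite eq_le s3 s2.
      by rewrite mulrC divfK // subrr h1 // h'0.
    apply: (@within_comp (R * X)%type (R * X)%type Y _ (`[0, 1]%classic `*` A)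
      (fun p => (2 * p.1 - 1, p.2)) h') => //.
      move=> [s x] [/= s01 Ax]; split=> //=.
      by move: s01; rewrite !in_itv /= => /andP[? ?]; apply/andP; split; lra.
    apply: continuous_subspaceT => -[s z].
    apply: (@for_pair (R * X)%type R X (s, z) (fun p => 2 * p.1 - 1) snd); last exact: cvg_snd.
    apply: (@for_add R R^o (R * X)%type (s, z)); last exact: for_cst.
    by apply: (@for_mul R (R * X)%type (s, z)); [exact: for_cst|exact: cvg_fst].
- move=> [s x] [/= s01 Ax]; rewrite /F /=; move: s01; rewrite in_itv /= => /andP[s0 s1].
  by case: ifP => s2; [apply: hB|apply: h'B]; split=> //=; rewrite ?in_itv /=;
    apply/andP; split; lra.
- by move=> x Ax; rewrite /F /= mulr0 divr_ge0 // h0.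
- move=> x Ax; rewrite /F /= ifF; last by apply/negbTE; rewrite -ltNge; lra.
  by rewrite mulr1 (_ : 2 - 1 = 1) ?h'1 //; lra.
Qed.

End Homotopy.

Section ComplexVectors.
Variables (R : realType) (k : nat) (T : topologicalType) (x : T).
Local Notation C := (R[i]^o).

Lemma for_real (f : T -> R) : {for x, continuous f} ->
  {for x, continuous ((fun y => (f y)%:C%C) : T -> C)}.
Proof. by move=> cf; apply: for_complex => //; exact: for_cst. Qed.

Lemma for_addv (f g : T -> 'rV[C]_k) : {for x, continuous f} -> {for x, continuous g} ->
  {for x, continuous (fun y => f y + g y)}.
Proof.
move=> cf cg; apply: for_mx => i j.
rewrite (_ : (fun _ => _) = fun y => f y i j + g y i j).
  exact: (@for_add R[i] R[i]^o T x _ _ (@for_coord _ _ _ _ _ _ i j cf) (@for_coord _ _ _ _ _ _ i j cg)).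
by apply/funext => y; rewrite mxE.
Qed.

Lemma for_scalev (f : T -> C) (g : T -> 'rV[C]_k) : {for x, continuous f} ->
  {for x, continuous g} -> {for x, continuous (fun y => f y *: g y)}.
Proof.
move=> cf cg; apply: for_mx => i j.
rewrite (_ : (fun _ => _) = fun y => f y * g y i j).
  exact: (@for_mul R[i] T x _ _ cf (@for_coord _ _ _ _ _ _ i j cg)).
by apply/funext => y; rewrite mxE.
Qed.

End ComplexVectors.

(** * Linear maps and projective transformations up to homotopy *)

Section LinearHomotopy.
Variables (R : realType) (m : nat).
Local Notation C := (R[i]^o).
Local Notation n := (m.+1 + m)%N.
Local Notation V := 'rV[R]_n.

Definition sphere : set V := [set v | `|v| = 1].
Definition nonzero : set V := [set v | v != 0].

Lemma sphere_neq0 v : sphere v -> v != 0.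
Proof. by move=> v1; rewrite -normr_eq0 v1 oner_eq0. Qed.

Lemma sphere_closed : closed sphere.
Proof.
apply: (@closed_comp _ _ (fun v : V => `|v|) [set 1]).
  by move=> v _; exact: norm_continuous.
by apply: accessible_closed_set1; apply: hausdorff_accessible; exact: norm_hausdorff.
Qed.

Lemma dec_neq0 (v : V) : v != 0 -> dec_t v != 0 \/ dec_u v != 0.
Proof. by move=> v0; apply/orP; rewrite -negb_and -enc_eq0 encK. Qed.

(* Each eigenvalue of [A] excludes at most one ray of directions. *)
Lemma exists_direction (A : 'M[C]_m) : A \in unitmx ->
  exists y : R, forall (s : R) (u : 'rV[C]_m), 0 <= s <= 1 -> u != 0 ->
    ((1 - s)%:C%C : C) *: (u *m A) + ((s%:C%C : C) * (1 +i* y)%C) *: u != 0.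
Proof.
move=> Au; have [rs rsE] := closed_field_poly_normal (char_poly A).
(* This y exceeds |Im z / Re z| for every eigenvalue z of A. If the map at some s < 1 were singular,
   - s / (1 - s) * (1 + i y) would be an eigenvalue, with quotient y; s = 0 is excluded because A is
   invertible. *)
exists (1 + \sum_(z <- rs) `|complex.Im z / complex.Re z|) => s u /andP[s0 s1] u0.
pose y := 1 + \sum_(z <- rs) `|complex.Im z / complex.Re z|; rewrite -/y; apply/eqP => uA.
have [s1'|s1'] := eqVneq s 1.
  move: uA; rewrite s1' subrr scale0r add0r mul1r => /eqP.
  rewrite scaler_eq0 (negbTE u0) orbF eq_complex /= => /andP[/eqP /eqP].
  by rewrite oner_eq0.
have s1p : 0 < 1 - s by rewrite subr_gt0 lt_neqAle s1'.
pose rho := s / (1 - s).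
pose lam : C := (- rho +i* - (rho * y))%C.
have lamE : u *m A = lam *: u.
  have : ((1 - s)%:C%C : C) *: (u *m A) = ((1 - s)%:C%C : C) *: (lam *: u).
    move/eqP: uA; rewrite addr_eq0 => /eqP ->.
    rewrite -scaleNr scalerA; congr (_ *: _); apply/eqP; rewrite eq_complex /= /rho.
    have s1n : 1 - s != 0 by rewrite gt_eqF.
    by apply/andP; split; apply/eqP; field.
  by move/scalerI; apply; rewrite eq_complex /= negb_and gt_eqF.
have lroot : root (char_poly A) lam.
  by rewrite -eigenvalue_root_char; apply/eigenvalueP; exists u.
have [rho0|rho0] := eqVneq rho 0.
  move: lamE; rewrite /lam rho0 mul0r oppr0 scale0r => uA0.
  by move/eqP: u0; apply; rewrite -(mulmxK Au u) uA0 mul0mx.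
have lin : lam \in rs.
  move: lroot; rewrite rsE rootZ ?lead_coef_eq0 ?monic_neq0 ?char_poly_monic //.
  by rewrite root_prod_XsubC.
have : `|y| <= \sum_(z <- rs) `|complex.Im z / complex.Re z|.
  rewrite (big_rem lam) //= -mulNr mulrAC divff ?oppr_eq0 // mul1r lerDl.
  exact: sumr_ge0.
have S0 : 0 <= \sum_(z <- rs) `|complex.Im z / complex.Re z| by exact: sumr_ge0.
by rewrite ger0_norm /y; lra.
Qed.

(** An explicit path in GL_m(C): a segment from A to the scalar theta = 1 + i y, with y from
    [exists_direction], and a segment from theta to 1 on the line Re = 1. The real factor moves from
    al to 1 along positive numbers. *)
Lemma homotopic_linear (al : R) (A : 'M[C]_m) : 0 < al -> A \in unitmx ->
  homotopic R sphere nonzero (fun v => enc (al * dec_t v) (dec_u v *m A)) id.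
Proof.
move=> al0 Au; have [y yP] := exists_direction Au.
pose theta : C := (1 +i* y)%C.
apply: (@homotopic_trans _ _ _ _ _ _ (fun v => enc (dec_t v) (theta *: dec_u v))).
- exact: sphere_closed.
- apply: (@homotopic_formula _ _ _ _ _ _ _ (fun q => enc (((1 - q.1) * al + q.1) * dec_t q.2)
    (((1 - q.1)%:C%C : C) *: (dec_u q.2 *m A) + ((q.1%:C%C : C) * theta) *: dec_u q.2))).
  + move=> s v s01 /sphere_neq0 v0; split.
      have c1 := @for_fst _ _ _ _ id (@for_id (R * V)%type (s, v)).
      have c2 := @for_snd _ _ _ _ id (@for_id (R * V)%type (s, v)).
      have c3 : {for (s, v), continuous (fun q : R * V => 1 - q.1)}.
        apply: (@for_add R R^o (R * V)%type (s, v)); first exact: for_cst.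
        exact: (@for_opp R R^o (R * V)%type (s, v)).
      have cu := for_dec_u c2.
      apply: for_enc.
        apply: (@for_mul R (R * V)%type (s, v)); last exact: for_dec_t.
        apply: (@for_add R R^o (R * V)%type (s, v)) => //.
        by apply: (@for_mul R (R * V)%type (s, v)) => //; exact: for_cst.
      apply: for_addv.
        exact: (for_scalev (for_real c3) (for_mulmx (M := A) cu)).
      apply: (for_scalev _ cu).
      exact: (@for_mul R[i] (R * V)%type (s, v) _ _ (for_real c1) (@for_cst _ _ _ _)).
    rewrite /nonzero /= enc_eq0 negb_and mulf_eq0 negb_or.
    have [t0|u0] := dec_neq0 v0; last by rewrite yP ?orbT.
    rewrite t0 andbT gt_eqF //; case/andP: s01 => s0 s1.
    have h : 0 <= (1 - s) * al by rewrite mulr_ge0 ?subr_ge0 // ltW.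
    have [->|s0'] := eqVneq s 0; first by lra.
    by have : 0 < s; [rewrite lt_neqAle eq_sym s0'|lra].
  + by move=> v _; rewrite /= subr0 mul1r addr0 mul0r scale1r scale0r addr0.
  + by move=> v _; rewrite /= subrr mul0r add0r mul1r scale0r add0r mul1r.
apply: (@homotopic_formula _ _ _ _ _ _ _ (fun q => enc (dec_t q.2)
  (((1 +i* ((1 - q.1) * y))%C : C) *: dec_u q.2))).
- move=> s v s01 /sphere_neq0 v0; split.
    have c1 := @for_fst _ _ _ _ id (@for_id (R * V)%type (s, v)).
    have c2 := @for_snd _ _ _ _ id (@for_id (R * V)%type (s, v)).
    apply: for_enc; first exact: for_dec_t.
    apply: for_scalev; last exact: for_dec_u.
    apply: for_complex; first exact: for_cst.
    apply: (@for_mul R (R * V)%type (s, v)); last exact: for_cst.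
    apply: (@for_add R R^o (R * V)%type (s, v)); first exact: for_cst.
    exact: (@for_opp R R^o (R * V)%type (s, v)).
  rewrite /nonzero /= enc_eq0 negb_and; have [->//|u0] := dec_neq0 v0.
  by rewrite scaler_eq0 negb_or u0 eq_complex /= negb_and oner_eq0 orbT.
- by move=> v _; rewrite /= subr0 mul1r.
- by move=> v _; rewrite /= subrr mul0r (_ : (1 +i* 0)%C = 1) ?scale1r ?encK.
Qed.

(* The C-linear part of the affine chart [j] at [z0], on vectors with vanishing
   coordinate [i]. *)
Definition hyperplane (i : 'I_m.+1) : 'M[C]_(m, m.+1) :=
  \matrix_(l, a) (a == lift i l)%:R.

Definition aff_diff (j : 'I_m.+1) (z0 : 'rV[C]_m.+1) : 'M[C]_(m.+1, m) :=
  \matrix_(a, l) (z0 0 j * (a == lift j l)%:R - (a == j)%:R * z0 0 (lift j l)).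

Lemma hyperplane_lift i (u : 'rV[C]_m) l : (u *m hyperplane i) 0 (lift i l) = u 0 l.
Proof.
rewrite mxE (bigD1 l) //= mxE eqxx mulr1 big1 ?addr0 // => l' ll'.
by rewrite mxE (inj_eq lift_inj) eq_sym (negbTE ll') mulr0.
Qed.

Lemma hyperplane_self i (u : 'rV[C]_m) : (u *m hyperplane i) 0 i = 0.
Proof. by rewrite mxE big1 // => l _; rewrite mxE (negbTE (neq_lift i l)) mulr0. Qed.

Lemma insD i (u u' : 'rV[C]_m) : ins i (u + u') = ins i u + u' *m hyperplane i.
Proof.
apply/rowP => a; case: (unliftP i a) => [l|] ->.
  by rewrite [RHS]mxE !ins_lift hyperplane_lift mxE.
by rewrite [RHS]mxE !ins_self hyperplane_self addr0.
Qed.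

Lemma aff_diffE j (z0 w : 'rV[C]_m.+1) l :
  (w *m aff_diff j z0) 0 l = z0 0 j * w 0 (lift j l) - w 0 j * z0 0 (lift j l).
Proof.
rewrite mxE (bigD1 (lift j l)) //= (bigD1 j) /=; last by rewrite neq_lift.
rewrite big1 ?addr0 => [|a /andP[/negbTE aj /negbTE al]]; last first.
  by rewrite mxE aj al mulr0 mul0r subrr mulr0.
rewrite !mxE !eqxx (negbTE (neq_lift j l)) eq_sym (negbTE (neq_lift j l)).
by rewrite mulr0 mul0r subr0 sub0r mulr1 mul1r mulrN mulrC.
Qed.

(* Up to a nonzero scalar, the increment of an affine chart is linear; this replaces
   its derivative. *)
Lemma affB j (z0 w : 'rV[C]_m.+1) : z0 0 j != 0 -> (z0 + w) 0 j != 0 ->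
  aff j (z0 + w) - aff j z0 = (z0 0 j * (z0 + w) 0 j)^-1 *: (w *m aff_diff j z0).
Proof.
move=> z0j zwj; apply/rowP => l; rewrite [RHS]mxE aff_diffE !mxE.
by move: z0j zwj; rewrite mxE => z0j zwj; field; rewrite zwj.
Qed.

Lemma aff_diff_ker j (z0 w : 'rV[C]_m.+1) : w *m aff_diff j z0 = 0 ->
  z0 0 j *: w = w 0 j *: z0.
Proof.
move=> /rowP wz; apply/rowP => a; rewrite mxE [RHS]mxE.
case: (unliftP j a) => [l|] ->; last by rewrite mulrC.
by have := wz l; rewrite aff_diffE [RHS]mxE => /eqP; rewrite subr_eq0 => /eqP.
Qed.

Lemma hyperplane_eq0 i (u u0 : 'rV[C]_m) (c d : C) : c != 0 ->
  c *: (u *m hyperplane i) = d *: ins i u0 -> u = 0.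
Proof.
move=> c0 /rowP cd; have d0 : d = 0.
  by have := cd i; rewrite mxE hyperplane_self [RHS]mxE ins_self mulr0 mulr1.
apply/rowP => l; have /eqP : c * u 0 l = 0.
  by have := cd (lift i l); rewrite d0 mxE hyperplane_lift [RHS]mxE mul0r.
by rewrite mulf_eq0 (negbTE c0) /= => /eqP ->; rewrite mxE.
Qed.

(** The kernel of [aff_diff] at a point is the line through that point. Its preimage under M is the
    line of [ins i u0], which meets the hyperplane of vectors with coordinate i zero only in 0. *)
Lemma aff_diff_unit i j (u0 : 'rV[C]_m) (M : 'M[C]_m.+1) : M \in unitmx ->
  (ins i u0 *m M) 0 j != 0 ->
  hyperplane i *m M *m aff_diff j (ins i u0 *m M) \in unitmx.
Proof.
move=> Mu z0j; rewrite -row_free_unit; apply: inj_row_free => u.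
rewrite !mulmxA => /aff_diff_ker uz; apply: (hyperplane_eq0 z0j).
by apply: (can_inj (mulmxK Mu)); rewrite -[LHS]scalemxAl -[RHS]scalemxAl; exact: uz.
Qed.

Definition transition i j (M : 'M[C]_m.+1) (v : V) : V :=
  enc (dec_t v) (aff j (ins i (dec_u v) *m M)).

Lemma transition_preserving i j (M : 'M[C]_m.+1) (a : V) : M \in unitmx ->
  (ins i (dec_u a) *m M) 0 j != 0 ->
  exists2 d : R, 0 < d & forall r, 0 < r < d -> homotopic R sphere nonzero
    (fun v => transition i j M (a + r *: v) - transition i j M a) id.
Proof.
move=> Mu; set z0 := ins i (dec_u a) *m M => z0j.
pose z (v : V) := z0 + dec_u v *m hyperplane i *m M.
have zE v : ins i (dec_u (a + v)) *m M = z v by rewrite dec_uD insD mulmxDl.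
have [d d0 dP] : exists2 d : R, 0 < d & forall v, `|v| < d -> z v 0 j != 0.
  have cz : {for (0 : V), continuous (fun v : V => nsq (z v 0 j))}.
    apply: for_nsq; apply: for_coord; apply: for_addv; first exact: for_cst.
    by do 2!apply: for_mulmx; apply: for_dec_u; exact: for_id.
  have z00 : 0 < nsq (z 0 0 j).
    rewrite nsq_gt0 /z (_ : dec_u 0 = 0) ?mul0mx ?addr0 //.
    by apply/rowP => l; rewrite !mxE.
  have /nbhs_ballP[d /= d0 dP] : nbhs (0 : V) (fun v : V => 0 < nsq (z v 0 j)).
    exact: (cz _ (open_nbhs_nbhs (conj (@open_gt _ 0) z00))).
  exists d => // v vd; rewrite -nsq_gt0; apply: dP.
  by rewrite -ball_normE /= sub0r normrN.
exists d => // r /andP[r0 rd].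
pose A := hyperplane i *m M *m aff_diff j z0.
have Au : A \in unitmx by exact: aff_diff_unit.
pose coef : C := (z0 0 j * z0 0 j)^-1 * (r%:C)%C.
have r0C : (r%:C)%C != 0 :> C by rewrite eq_complex /= eqxx andbT gt_eqF.
have coef0 : coef != 0 by rewrite mulf_neq0 ?invr_eq0 ?mulf_neq0.
apply: (@homotopic_trans _ _ _ _ _ _ (fun v => enc (r * dec_t v) (dec_u v *m (coef *: A)))).
- exact: sphere_closed.
- have small s v : 0 <= s <= 1 -> sphere v -> z (((1 - s) * r) *: v) 0 j != 0.
    move=> /andP[s0 s1] v1; have sr : 0 <= (1 - s) * r by rewrite mulr_ge0 ?subr_ge0 // ltW.
    apply: dP; rewrite normrZ v1 mulr1 ger0_norm //.
    by apply: le_lt_trans rd; rewrite ler_piMl ?gerBl // ltW.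
  (* By [affB] only a scalar factor of the increment is nonlinear in v. The homotopy shrinks its
     argument from r v to 0, where it becomes a constant, and leaves the linear factor alone. *)
  apply: (@homotopic_formula R V V sphere nonzero _ _ (fun q : R * V => enc (r * dec_t q.2)
    (((z0 0 j * z (((1 - q.1) * r) *: q.2) 0 j)^-1 * (r%:C)%C) *: (dec_u q.2 *m A)))).
  + move=> s v s01 v1; split.
      have c1 := @for_fst _ _ _ _ id (@for_id (R * V)%type (s, v)).
      have c2 := @for_snd _ _ _ _ id (@for_id (R * V)%type (s, v)).
      have c3 : {for (s, v), continuous (fun q : R * V => (1 - q.1) * r)}.
        apply: (@for_mul R (R * V)%type (s, v)); last exact: for_cst.
        apply: (@for_add R R^o (R * V)%type (s, v)); first exact: for_cst.
        exact: (@for_opp R R^o (R * V)%type (s, v)).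
      have cu := for_dec_u c2.
      apply: for_enc.
        by apply: (@for_mul R (R * V)%type (s, v)); [exact: for_cst|exact: for_dec_t].
      apply: for_scalev; last exact: for_mulmx.
      apply: (@for_mul R[i] (R * V)%type (s, v)); last exact: for_cst.
      apply: (@for_inv R[i] (R * V)%type (s, v)); first by rewrite mulf_neq0 // small.
      apply: (@for_mul R[i] (R * V)%type (s, v)); first exact: for_cst.
      apply: for_coord; apply: for_addv; first exact: for_cst.
      do 2!apply: for_mulmx; apply: for_dec_u.
      exact: (@for_scale R V (R * V)%type (s, v)).
    rewrite /nonzero /= enc_eq0 negb_and mulf_eq0 negb_or gt_eqF //=.
    have [->//|u0] := dec_neq0 (sphere_neq0 v1).
    rewrite scaler_eq0 negb_or !mulf_neq0 ?invr_eq0 ?mulf_neq0 ?small //=.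
    by apply/orP; right; apply: contra_neq u0 => uA; rewrite -(mulmxK Au (dec_u v)) uA mul0mx.
  + move=> v v1; rewrite /= /transition encB dec_tD dec_tZ [dec_t a + _]addrC addrK; congr enc.
    have rv : z (r *: v) 0 j != 0 by have := small 0 v; rewrite subr0 mul1r; apply; rewrite ?lexx ?ler01.
    rewrite subr0 mul1r zE -[ins i (dec_u a) *m M]/z0 /z affB //.
    by rewrite -/(z (r *: v)) dec_uZ -!scalemxAl scalerA /A !mulmxA.
  + move=> v v1; rewrite /= subrr mul0r scale0r; congr enc.
    rewrite -scalemxAr /coef; congr ((_ * _)^-1 * _ *: _).
    by rewrite /z (_ : dec_u 0 = 0) ?mul0mx ?addr0 //; apply/rowP => l; rewrite !mxE.
by apply: homotopic_linear => //; rewrite unitmxZ ?unitfE.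
Qed.

(* Complex conjugation on C^m and [-1] on R; with this layout of the real
   coordinates it is [-1] on R^(m+1), a multiplication by a complex number if
   [J] is taken as imaginary unit. *)
Definition conj_neg (v : V) : V := row_mx (- lsubmx v) (rsubmx v).

Lemma conj_negE v : conj_neg v = enc (- dec_t v) (conj_row (dec_u v)).
Proof.
apply/rowP => k; rewrite /conj_neg /enc; case: (split_ordP k) => a ->.
  rewrite !row_mxEl !mxE; case: (unliftP ord0 a) => [l|] -> //.
  by rewrite !mxE.
by rewrite !row_mxEr !mxE.
Qed.

Lemma conj_negK : involutive conj_neg.
Proof. by move=> v; rewrite /conj_neg row_mxKl row_mxKr opprK hsubmxK. Qed.

Lemma conj_negD v w : conj_neg (v + w) = conj_neg v + conj_neg w.
Proof. by rewrite /conj_neg add_row_mx !linearD. Qed.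

Lemma conj_negZ r v : conj_neg (r *: v) = r *: conj_neg v.
Proof. by rewrite /conj_neg scale_row_mx !linearZ /= scalerN. Qed.

Lemma conj_neg_norm v : `|conj_neg v| = `|v|.
Proof.
suff le w : `|conj_neg w| <= `|w|.
  by apply/eqP; rewrite eq_le le -{1}(conj_negK v) le.
apply/rV_norm_le => // k; rewrite /conj_neg; case: (split_ordP k) => a ->.
  by rewrite row_mxEl !mxE normrN rV_norm_coord.
by rewrite row_mxEr !mxE rV_norm_coord.
Qed.

Lemma conj_neg_continuous : continuous conj_neg.
Proof.
move=> v; have cv i := @for_coord V R 1 n id v 0 i (@for_id _ _).
apply: for_mx => b k; rewrite ord1; case: (split_ordP k) => a ->.
  rewrite (_ : (fun _ => _) = fun w : V => - w 0 (lshift m a)).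
    exact: (@for_opp R R^o V v).
  by apply/funext => w; rewrite /conj_neg row_mxEl !mxE.
rewrite (_ : (fun _ => _) = fun w : V => w 0 (rshift m.+1 a)); first exact: cv.
by apply/funext => w; rewrite /conj_neg row_mxEr !mxE.
Qed.

Lemma homotopic_conj_neg (J : 'M[R]_m.+1) : J *m J = - 1%:M ->
  homotopic R sphere nonzero conj_neg id.
Proof.
(* The path c + d J joins -1 to 1 in R[J]. It is invertible because (c + d J)(c - d J) = c^2 + d^2,
   and c vanishes only at s = 1/2, where d = 1/4. *)
move=> JJ; pose c (s : R) := 2 * s - 1; pose d (s : R) := s * (1 - s).
pose y (v : V) := lsubmx v : 'rV[R]_m.+1.
apply: (@homotopic_formula R V V sphere nonzero _ _ (fun q : R * V =>
  row_mx (c q.1 *: y q.2 + d q.1 *: (y q.2 *m J)) (rsubmx q.2) : V)).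
- move=> s v s01 v1; split.
    pose T := (R * V)%type; pose x : T := (s, v).
    have c1 : {for x, continuous (fun q : T => q.1)} by exact: cvg_fst.
    have c2 : {for x, continuous (fun q : T => q.2)} by exact: cvg_snd.
    have cv i : {for x, continuous (fun q : T => q.2 0 i)} := @for_coord T R 1 n _ x 0 i c2.
    apply: for_mx => b k; rewrite ord1; case: (split_ordP k) => a ->.
      rewrite (_ : (fun _ => _) = fun q : T => c q.1 * q.2 0 (lshift m a) +
        d q.1 * \sum_k q.2 0 (lshift m k) * J k a).
        apply: (@for_add R R^o T x); apply: (@for_mul R T x).
        * apply: (@for_add R R^o T x); last exact: for_cst.
          by apply: (@for_mul R T x); [exact: for_cst|exact: c1].
        * exact: cv.
        * apply: (@for_mul R T x); first exact: c1.
          apply: (@for_add R R^o T x); first exact: for_cst.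
          exact: (@for_opp R R^o T x).
        * apply: (@for_sum T x R) => l.
          by apply: (@for_mul R T x); [exact: cv|exact: for_cst].
      apply/funext => q; rewrite row_mxEl !mxE; congr (_ + _ * _).
      by apply: eq_bigr => l _; rewrite !mxE.
    rewrite (_ : (fun _ => _) = fun q : T => q.2 0 (rshift m.+1 a)); first exact: cv.
    by apply/funext => q; rewrite row_mxEr !mxE.
  apply: contra_neqN (sphere_neq0 v1) => /eqP /= e0.
  have [y0 x0] : c s *: y v + d s *: (y v *m J) = 0 /\ rsubmx v = 0.
    by have := eq_row_mx (etrans e0 (esym (@row_mx0 _ 1 m.+1 m))).
  rewrite -(hsubmxK v) x0 (_ : lsubmx v = 0) ?row_mx0 //; rewrite -/(y v).
  have : (c s ^+ 2 + d s ^+ 2) *: y v = 0.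
    have -> : (c s ^+ 2 + d s ^+ 2) *: y v =
        c s *: (c s *: y v + d s *: (y v *m J)) -
        d s *: ((c s *: y v + d s *: (y v *m J)) *m J).
      rewrite mulmxDl -!scalemxAl -mulmxA JJ mulmxN mulmx1 !scalerDr !scalerA scalerN.
      by rewrite opprD opprK addrACA [d s * c s]mulrC addrA subrK scalerDl !expr2.
    by rewrite y0 mul0mx !scaler0 subr0.
  move/eqP; rewrite scaler_eq0 gt_eqF => [/eqP//|].
  have [->|s2] := eqVneq s (1 / 2); rewrite /c /d; first by nra.
  by rewrite ltr_pwDl ?sqr_ge0 // exprn_even_gt0 //=; apply: contra_neq s2; lra.
- move=> v _; rewrite /= /c /d mulr0 sub0r scaleN1r mul0r scale0r addr0 //.
- move=> v _; rewrite /= /c /d subrr mulr0 scale0r addr0 mulr1.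
  by rewrite (_ : 2 - 1 = 1) ?scale1r ?hsubmxK //; lra.
Qed.

End LinearHomotopy.

Section Orientation.
Variables (R : realType) (m : nat) (J : 'M[R]_m.+1).
Hypotheses (JT : J^T = - J) (JJ : J *m J = - 1%:M).
Local Notation C := (R[i]^o).
Local Notation E := 'rV[C]_m.+1.
Local Notation P := (@punctured R m).
Local Notation X := (P * R)%type.
Local Notation n := (m.+1 + m)%N.
Local Notation V := 'rV[R]_n.
Local Notation W := (cylinder JJ).
Local Notation cls := (glue_class JJ : X -> W).
Local Notation mid_set := ([set s : R | -1 < s] `&` [set s | s < 1]).

Lemma complexify_unit : complexify J \in unitmx.
Proof.
have : - complexify J *m complexify J = 1%:M by rewrite mulNmx complexify2 ?opprK.
by case/mulmx1_unit.
Qed.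

Lemma coords_mid i (x : X) : mid_set (clamp x.2) -> coords i 1 0 x = enc x.2 (aff i (val x.1)).
Proof.
move=> x2; rewrite /coords subr0 mul1r; congr enc; apply: clamp_id.
move: x2 => [] /=; rewrite /clamp lt_max gt_max gt_min lt_min !ltxx /=.
by move=> /andP[_ v0] /andP[_ v1]; rewrite (ltW v0) (ltW v1).
Qed.

Lemma mid_chart_preserving p i q j w :
  chart_dom (mid_chart JJ p i) w -> chart_dom (mid_chart JJ q j) w ->
  orientation_preserving_at
    (chart_map (mid_chart JJ q j) \o chart_inv (mid_chart JJ p i))
    (chart_map (mid_chart JJ p i) w).
Proof.
move=> [y yN <-] dw; rewrite sheet_chart_mapE //; set a := coords i 1 0 y.
pose D := sheet_dom J q j mid_set.
have ya : cls (param i 1 0 a) = cls y.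
  by apply: cls_same; apply: coordsK; [rewrite mulr1|case: yN].
set h := _ \o _.
have hE v : h v = chart_map (mid_chart JJ q j) (cls (param i 1 0 v)) by [].
have oD : open D by apply: sheet_dom_open; exact: openI (@open_gt _ (-1)) (@open_lt _ 1).
have hD v x : cls x = cls (param i 1 0 v) -> D x -> h v = enc x.2 (aff j (val x.1)).
  by move=> xv Dx; rewrite hE -xv sheet_chart_mapE // coords_mid //; case: Dx.
(* The representative that lies in the second sheet at a does so near a, as D is open, so for small
   r a single formula describes the transition. *)
have : D (param i 1 0 a) \/ D (flip J (param i 1 0 a)).
  by move: dw; rewrite -ya => -[z zD zy]; exact: (sheet_dom_sat (JJ := JJ) (esym zy) zD).
have near_ball (f : V -> X) : {for a, continuous f} -> D (f a) ->
    exists2 e : R, 0 < e & forall r v, 0 < r < e -> sphere v -> D (f (a + r *: v)).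
  move=> cf Da; have /nbhs_ballP[e /= e0 eP] : nbhs a (f @^-1` D).
    by apply: cf; exact: open_nbhs_nbhs.
  exists e => // r v /andP[r0 re] v1; apply: eP.
  by rewrite -ball_normE /= opprD addNKr normrN normrZ v1 mulr1 gtr0_norm.
have tE (v : V) : dec_t v = (param i 1 0 v).2 by rewrite /= add0r mul1r.
case=> Da.
- have [e e0 eP] := near_ball _ (@param_continuous R m i 1 0 a) Da.
  have trE v : D (param i 1 0 v) -> h v = transition i j 1%:M v.
    by move=> Dv; rewrite (hD v _ erefl Dv) /transition mulmx1 val_param tE.
  have [d d0 dP] : exists2 d : R, 0 < d & forall r, 0 < r < d ->
      homotopic R (@sphere R m) (@nonzero R m)
      (fun v => transition i j 1%:M (a + r *: v) - transition i j 1%:M a) id.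
    apply: transition_preserving; first exact: unitmx1.
    by rewrite mulmx1 -(val_param i 1 0); case: Da.
  near=> r.
  have r0 : 0 < r by near: r; exact: nbhs_right_gt.
  have rd : r < d by near: r; exact: nbhs_right_lt.
  have re : r < e by near: r; exact: nbhs_right_lt.
  apply: (homotopic_ext _ (dP r _)); last by rewrite r0.
  by move=> v v1; rewrite !trE //; apply: eP => //; rewrite r0.
- have cfl : {for a, continuous (fun v => flip J (param i 1 0 v))}.
    apply: (@for_comp V a X X (param i 1 0) (flip J)); first exact: param_continuous.
    exact: flip_continuous.
  have [e e0 eP] := near_ball _ cfl Da.
  have trE v : D (flip J (param i 1 0 v)) ->
      h v = transition i j (complexify J) (conj_neg v).
    move=> Dv; rewrite (hD v _ (cls_flip JJ _) Dv) /transition conj_negE enc_t enc_u.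
    by rewrite (val_flip JJ) val_param /tau conj_ins /= add0r mul1r.
  have [d d0 dP] : exists2 d : R, 0 < d & forall r, 0 < r < d ->
      homotopic R (@sphere R m) (@nonzero R m)
      (fun v => transition i j (complexify J) (conj_neg a + r *: v) -
        transition i j (complexify J) (conj_neg a)) id.
    apply: transition_preserving; first exact: complexify_unit.
    rewrite conj_negE enc_u -conj_ins -(val_param i 1 0) -[_ *m _]/(tau J _) -(val_flip JJ).
    by case: Da.
  near=> r.
  have r0 : 0 < r by near: r; exact: nbhs_right_gt.
  have rd : r < d by near: r; exact: nbhs_right_lt.
  have re : r < e by near: r; exact: nbhs_right_lt.
  (* Precomposed with [conj_neg], which preserves the sphere, the homotopy of the projective
     transformation ends at [conj_neg], and [homotopic_conj_neg] leads from there to the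
     identity. *)
  apply: (homotopic_trans (@sphere_closed R m) _ (homotopic_conj_neg JJ)).
  have := dP r; rewrite r0 => /(_ rd) Hr.
  apply: homotopic_ext (homotopic_precomp (k := @conj_neg R m) _ (@conj_neg_continuous R m) Hr).
    move=> v v1 /=; rewrite -conj_negZ -conj_negD !trE //.
    by apply: eP => //; rewrite r0.
  by move=> v v1; rewrite /sphere /= conj_neg_norm.
Unshelve. all: by end_near. Qed.

Definition mid_atlas : set (chart (euclidean R n) W) :=
  [set c | exists p i, c = mid_chart JJ p i].

Lemma mid_atlas_oriented : oriented_atlas mid_atlas.
Proof.
split=> [w wb|_ _ [p [i ->]] [q [j ->]] w cw dw]; last exact: mid_chart_preserving.
have [x [p [i [xw xp xi]]]] := has_rep JT (JJ := JJ) w.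
exists (mid_chart JJ p i); first by exists p, i.
exists x => //; split=> //=; rewrite (cylinder_boundary JT JJ) in wb.
split; rewrite lt_neqAle ?clamp_ge ?clamp_le andbT; apply/eqP => x1; apply: wb.
  by exists (flip J x); rewrite ?cls_flip //= clampN -x1 opprK.
by exists x.
Qed.

End Orientation.

Lemma exists_complex_structure (R : realType) (N q : nat) : N = (q + q)%N ->
  exists2 J : 'M[R]_N, J^T = - J & J *m J = - 1%:M.
Proof.
move=> ->; exists (block_mx 0 1%:M (- 1%:M) 0).
  by rewrite tr_block_mx !trmx0 linearN /= trmx1 opp_block_mx oppr0 opprK.
rewrite mulmx_block !mul0mx !mulmx0 !mul1mx !mulmx1 !addr0 !add0r.
by rewrite [in RHS]scalar_mx_block opp_block_mx !oppr0.
Qed.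

Theorem theorem5p1 (R : realType) (k : nat) :
  exists (n : nat) (W : topologicalType) (A : set (chart (euclidean R n) W)),
    [/\ manifold_with_boundary R n W,
        compact [set: W],
        oriented_atlas A &
        homeomorphic (boundary R n W) (complex_projective R (2 * k + 1))].
Proof.
(* Here the parity enters: J^2 = -1 gives (det J)^2 = (-1)^(m+1), so m + 1 has to be even; it is 2
   (k + 1). *)
have [J JT JJ] : exists2 J : 'M[R]_((2 * k + 1).+1), J^T = - J & J *m J = - 1%:M.
  by apply: (@exists_complex_structure R _ k.+1); rewrite addn1 mul2n -addnn addnS.
exists ((2 * k + 1).+1 + (2 * k + 1))%N, (cylinder JJ), (@mid_atlas R _ J JJ); split.
- exact: cylinder_manifold.
- exact: cylinder_compact.
- exact: mid_atlas_oriented.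
- exact: boundary_homeomorphic.
Qed.
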